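(* Let $\mathbf{G}=(J,\mathcal{B},E,\lambda)$ be a graphing with average degree $\overline{d}$ and edge measure $\eta$, and let $\mathbf{H}=(J,F)$ be a hyperfinite spanning subforest of $\mathbf{G}$. Then $$\alpha(X)=\frac{\overline{d}}{2}\,\eta(X\cap F)$$ defines a measure on the Borel subsets of $E$ such that $\alpha(X)\le\rho(X)$ for every Borel set $X\subseteq E$, and $\alpha(E)=\rho(E)$.
   Context: A graphing is a quadruple $\mathbf{G}=(J,\mathcal{B},E,\lambda)$, where $(J,\mathcal{B})$ is a standard Borel space, $\lambda$ is a probability measure on $\mathcal{B}$, and $E$ is a Borel set of unordered pairs of distinct points of $J$ (identified with a symmetric Borel subset of $J\times J$ disjoint from the diagonal), such that all degrees of the graph $(J,E)$ are bounded by a finite integer $D\ge 0$ and $$\int_A \deg_B(x)\,d\lambda(x)=\int_B \deg_A(x)\,d\lambda(x)\qquad\text{for all }A,B\in\mathcal{B},$$ where $\deg_B(x)$ is the number of edges from $x$ to points of $B$. Borel subsets $X\subseteq E$ are sets of (unordered) edges, i.e. they are identified with symmetric Borel subsets of $J\times J$. For every Borel $X\subseteq E$, $\mathbf{G}^X=(J,\mathcal{B},X,\lambda)$ is again a graphing (a subgraphing of $\mathbf{G}$). The average degree is $\overline{d}=\overline{d}_{\mathbf{G}}=\int_J\deg(u)\,d\lambda(u)$, assumed positive. The edge measure $\eta=\eta_{\mathbf{G}}$ is the probability measure on the product sigma-algebra $\mathcal{B}\times\mathcal{B}$ extending $\eta(A\times B)=\frac{1}{\overline{d}}\int_A\deg_B(x)\,d\lambda(x)$;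 it is symmetric, supported on $E$, and satisfies $\eta(X)=\frac1{\overline d}\int_J\deg_X(u)\,d\lambda(u)$ for Borel $X\subseteq E$, where $\deg_X(u)$ is the number of edges of $X$ incident with $u$. For Borel $X\subseteq E$, $\rho(X)=1-\mathsf{E}\big(1/|V(\mathbf{G}^X_{\mathbf{u}})|\big)$, where $\mathbf{u}$ is a random point of $J$ with distribution $\lambda$ and $V(\mathbf{G}^X_u)$ is the node set of the connected component of $(J,X)$ containing $u$ (with $1/\infty=0$). A graphing is hyperfinite if for every $\varepsilon>0$ there is a Borel subset $X$ of its edge set whose measure under the edge measure of the graphing is less than $\varepsilon$, such that all connected components of the graph obtained by deleting the edges in $X$ are finite. A hyperfinite spanning subforest of $\mathbf{G}$ is a subgraphing $\mathbf{H}=(J,\mathcal{B},F,\lambda)$, with $F\subseteq E$ Borel, that is a hyperfinite graphing and is such that $F$ restricted to each connected component of $\mathbf{G}$ is a spanning tree of that component (so every component of $\mathbf{H}$ is a tree and $\mathbf{H}$ has the same connected components, as node sets, as $\mathbf{G}$). *)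

(* Defs.v *)
From HB Require Import structures.
From mathcomp Require Import all_boot all_order all_algebra.
From mathcomp Require Import all_classical all_reals all_analysis.

Set Implicit Arguments.
Unset Strict Implicit.
Unset Printing Implicit Defensive.

Import Order.TTheory GRing.Theory Num.Theory.
Import numFieldNormedType.Exports.

Local Open Scope classical_set_scope.
Local Open Scope ring_scope.
Local Open Scope ereal_scope.

(* The sigma-algebra of J is, up to a bijection, the Borel sigma-algebra of a
   Polish space (a separated, separable, complete metric space). *)
Definition standard_borel (R : realType) (d : measure_display)
    (J : measurableType d) : Prop :=
  exists (T : completePseudoMetricType R) (f : J -> T),
    [/\ hausdorff_space T,
        (exists2 S : set T, countable S & dense S),
        bijective f &
        forall A : set J,
          measurable A <-> exists2 B : set T, <<s open >> B & A = f @^-1` B].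

(* A set of unordered pairs of points of J is encoded throughout as the
   symmetric set of the corresponding ordered pairs. *)
Definition symmetric_set (J : Type) (X : set (J * J)) : Prop :=
  forall x y, X (x, y) -> X (y, x).

Definition borel_edges (d : measure_display) (J : measurableType d)
    (E : set (J * J)) : set (set (J * J)) :=
  [set X | [/\ measurable X, symmetric_set X & X `<=` E]].

Definition deg (R : realType) (J : choiceType) (X : set (J * J)) (B : set J)
    (x : J) : \bar R :=
  counting (xsection X x `&` B).

Definition graphing (R : realType) (d : measure_display)
    (J : measurableType d) (lambda : probability J R) (E : set (J * J)) : Prop :=
  [/\ standard_borel R J,
      [/\ measurable E, symmetric_set E & forall x, ~ E (x, x)],
      (exists D : nat, forall x, deg R E setT x <= D%:R%:E) &
      forall A B : set J, measurable A -> measurable B ->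
        \int[lambda]_(x in A) deg R E B x = \int[lambda]_(x in B) deg R E A x].

Definition avg_degree (R : realType) (d : measure_display)
    (J : measurableType d) (lambda : probability J R) (E : set (J * J)) : R :=
  fine (\int[lambda]_x deg R E setT x).

(* Rectangles form a generating pi-system of the product sigma-algebra, so
   this determines eta. *)
Definition edge_measure (R : realType) (d : measure_display)
    (J : measurableType d) (lambda : probability J R) (E : set (J * J))
    (eta : probability (J * J)%type R) : Prop :=
  forall A B : set J, measurable A -> measurable B ->
    eta (A `*` B) =
    ((avg_degree lambda E)^-1)%:E * \int[lambda]_(x in A) deg R E B x.

Definition joined (J : choiceType) (X : set (J * J)) (u v : J) : Prop :=
  exists p : seq J, path (fun x y => (x, y) \in X) u p /\ last u p = v.

Definition component (J : choiceType) (X : set (J * J)) (u : J) : set J :=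
  [set v | joined X u v].

(* The inverse in \bar R satisfies +oo^-1 = 0; components are nonempty, so
   the value is always finite and fine is harmless. *)
Definition rho (R : realType) (d : measure_display)
    (J : measurableType d) (lambda : probability J R) (X : set (J * J)) :
    \bar R :=
  1 - 'E_lambda[fun u => fine (@counting J R (component X u))^-1].

Definition hyperfinite (R : realType) (d : measure_display)
    (J : measurableType d) (lambda : probability J R) (E : set (J * J)) : Prop :=
  exists2 eta : probability (J * J)%type R, edge_measure lambda E eta &
    forall eps : R, (0 < eps)%R ->
      exists X : set (J * J),
        [/\ borel_edges E X, eta X < eps%:E &
            forall u, finite_set (component (E `\` X) u)].

Definition tree_on (J : choiceType) (V : set J) (T : set (J * J)) : Prop :=
  [/\ T `<=` V `*` V,
      forall u v, V u -> V v -> joined T u v &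
      forall c : seq J, (2 < size c)%N -> ~ ucycle (fun x y => (x, y) \in T) c].

Definition hyperfinite_spanning_subforest (R : realType) (d : measure_display)
    (J : measurableType d) (lambda : probability J R)
    (E F : set (J * J)) : Prop :=
  [/\ borel_edges E F, hyperfinite lambda F &
      forall u, tree_on (component E u)
                        (F `&` (component E u `*` component E u))].

Definition is_measure_on (R : realType) (T : Type) (S : set (set T))
    (mu : set T -> \bar R) : Prop :=
  [/\ mu set0 = 0,
      forall X, S X -> 0 <= mu X &
      forall X : (set T)^nat, (forall n, S (X n)) -> trivIset setT X ->
        mu (\bigcup_n X n) = \sum_(n <oo) mu (X n)].

(* Main.v *)
Require Import Defs.
From HB Require Import structures.
From mathcomp Require Import all_boot all_order all_algebra.
From mathcomp Require Import all_classical all_reals all_analysis.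
From mathcomp Require Import measurable_realfun.

Set Implicit Arguments.
Unset Strict Implicit.
Unset Printing Implicit Defensive.

Import Order.TTheory GRing.Theory Num.Theory.
Import numFieldNormedType.Exports.

Local Open Scope classical_set_scope.
Local Open Scope ring_scope.
Local Open Scope ereal_scope.

(* Let M(S) be the integral of the out-degree in S, so that M = dbar * eta.
   For a forest Y with finite components and a Borel set A that meets all of
   them, send along each edge (x, y) the flow #(A & branch) / #(A & C), where C
   is the component and branch the part of C - x that contains y.  The two flows
   along an edge add up to 1 and the flow out of x is 1 - 1_A(x) / #(A & C), so
   the symmetry of M gives  M(Y) / 2 = int (1 - 1_A(x) / #(A & C(x))).

   Remove from F a set N of small measure such that F - N has finite
   components.  For Y = (X & F) - N and A = J the right-hand side is
   rho(Y) <= rho(X), hence alpha(X) <= rho(X).  For Y = F - N let A consist of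
   the endpoints of N and of the components of Y free of such endpoints; the
   latter are components of E, so the right-hand side is at least rho(E) minus
   the measure of the endpoints of N, which is at most M(N).

   All the functions involved are measurable because E is a countable disjoint
   union of graphs of Borel functions (Lusin-Novikov).  This follows from
   Novikov's separation theorem, Borel sets being handled as injective
   projections of closed subsets of the Baire space. *)

(** * Borel sets as projections of closed sets *)

Section codes.
Variables (X : Type) (c : X -> nat -> nat).

(* {(c x, w x) | x in A} is closed in the square of the Baire space; the finite
   lists l range over basic neighbourhoods of (s, t). *)
Definition closed_code (w : X -> nat -> nat) (A : set X) : Prop :=
  forall s t : nat -> nat,
  (forall l : seq nat, exists2 x, A x &
     {in l, forall i, c x i = s i /\ w x i = t i}) ->
  exists x, [/\ A x, c x = s & w x = t].

(** Since [w] is a function of the point, for injective [c] the projection of the closed set to the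
    first coordinate is injective. The notion is thus narrower than that of an analytic set. *)
Definition Souslin (A : set X) : Prop := exists w, closed_code w A.

(** Asking the same of the complement builds closure under complements in, which makes the class a
    sigma-algebra. *)
Definition biSouslin (A : set X) : Prop := Souslin A /\ Souslin (~` A).

Lemma Souslin0 : Souslin set0.
Proof.
by exists (fun=> id) => s t /(_ [::])[].
Qed.

Lemma Souslin_cylinder (A : set X) i (P : set nat) :
  Souslin A -> Souslin (A `&` [set x | P (c x i)]).
Proof.
move=> [w wA]; exists w => s t st.
have [l|x [Ax cx wx]] := wA s t.
  by have [x [Ax _] xl] := st l; exists x.
exists x; split=> //; split=> //=; rewrite cx.
by have [y [_ /= Py]] := st [:: i]; move=> /(_ i (mem_head _ _))[<- _].
Qed.

(** The new code of a point x of [A n] is n followed by [w n x]. Disjointness makes n a function of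
    x, so the code remains single-valued. *)
Lemma SouslinU_disjoint (A : nat -> set X) :
  (forall n, Souslin (A n)) -> trivIset setT A -> Souslin (\bigcup_n A n).
Proof.
move=> /choice[w wA] tA.
have [m mA] : {m : X -> nat | forall n x, A n x -> m x = n}.
  apply: cid; suff /choice[m] : forall x, exists m, forall n, A n x -> m = n.
    by move=> hm; exists m => n x; exact: hm.
  move=> x; have [[m Am]|nA] := pselect (exists n, A n x); last first.
    by exists 0%N => n An; exfalso; apply: nA; exists n.
  by exists m => n An; apply: (tA m n) => //; exists x.
exists (fun x i => if i is j.+1 then w (m x) x j else m x) => s t st.
have [l|x [Ax cx wx]] := wA (t 0%N) s (fun i => t i.+1).
  have [x [n _ Anx] xl] := st (0%N :: l ++ map S l).
  have [_ mx] := xl 0%N (mem_head _ _).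
  have En := mA _ _ Anx; exists x; first by rewrite -mx En.
  move=> i il; split.
    by apply: (xl i _).1; rewrite inE mem_cat il orbT.
  rewrite -mx; apply: (xl i.+1 _).2.
  by rewrite inE mem_cat map_f ?orbT.
exists x; split=> //; first by exists (t 0%N).
have En := mA _ _ Ax.
by apply/funext => -[|j] //=; rewrite En ?wx.
Qed.

Hypothesis c_inj : injective c.

(** The codes for all the [A n] are packed into one sequence by pairing indices. Injectivity of [c]
    shows that the points found for different n coincide. *)
Lemma SouslinI (A : nat -> set X) :
  (forall n, Souslin (A n)) -> Souslin (\bigcap_n A n).
Proof.
move=> /choice[w wA].
exists (fun x i => if pickle_inv i is Some p then w p.1 x p.2 else 0%N) => s t st.
have h n : exists x, [/\ A n x, c x = s & w n x = fun j => t (pickle (n, j))].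
  apply: wA => l.
  have [x Ax xl] := st (l ++ [seq pickle (n, j) | j <- l]).
  exists x; first exact: Ax.
  move=> i il; split; first by apply: (xl i _).1; rewrite mem_cat il.
  have := (xl (pickle (n, i)) _).2; rewrite pickleK_inv; apply.
  by rewrite mem_cat (map_f (fun j => pickle (n, j))) ?orbT.
have [x [_ cx _]] := h 0%N.
have hx n : A n x /\ w n x = fun j => t (pickle (n, j)).
  by have [y [Ay cy wy]] := h n; have -> : x = y by apply: c_inj; rewrite cx.
exists x; split=> //; first by move=> n _; exact: (hx n).1.
(* At a position that encodes no pair, the neighbourhood given by this single position forces [t i]
   to be the default value 0. *)
apply/funext => i; have [y _ /(_ i (mem_head _ _))[_]] := st [:: i].
have := @pickle_invK (nat * nat)%type i.
by case: (pickle_inv i) => [[n j] /= <- _|//]; rewrite (hx n).2.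
Qed.

End codes.
Section sigma_algebra_biSouslin.
Variables (X : Type) (c : X -> nat -> nat).
Hypothesis c_inj : injective c.

Lemma biSouslinC (A : set X) : biSouslin c A -> biSouslin c (~` A).
Proof. by move=> [? ?]; split; rewrite ?setCK. Qed.

(** The union is first made disjoint. Each piece is an intersection of sets [A k] and complements of
    such sets, hence Souslin. *)
Lemma biSouslinU (A : nat -> set X) :
  (forall n, biSouslin c (A n)) -> biSouslin c (\bigcup_n A n).
Proof.
move=> bA; split; last first.
  by rewrite setC_bigcup; apply: SouslinI => // n; exact: (bA n).2.
rewrite seqDU_bigcup_eq; apply: SouslinU_disjoint; last exact: trivIset_seqDU.
move=> n; pose B k := if (k < n)%N then ~` A k else A n.
have -> : seqDU A n = \bigcap_k B k.
  apply/seteqP; split=> [x [Anx]|x Bx].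
    move=> nA k _; rewrite /B; case: ifPn => // kn Akx; apply: nA.
    by rewrite -bigcup_mkord; exists k.
  split; first by have := Bx n I; rewrite /B ltnn.
  by rewrite -bigcup_mkord => -[k /= kn]; have := Bx k I; rewrite /B kn.
apply: SouslinI => // k; rewrite /B; case: ifPn => _.
  exact: (bA k).2.
exact: (bA n).1.
Qed.

Lemma biSouslinI (A : nat -> set X) :
  (forall n, biSouslin c (A n)) -> biSouslin c (\bigcap_n A n).
Proof.
move=> bA; rewrite -[X in biSouslin _ X]setCK setC_bigcap.
by apply: biSouslinC; apply: biSouslinU => n; exact: biSouslinC.
Qed.

Hypothesis cT : Souslin c setT.

Lemma biSouslin_cylinder i (P : set nat) : biSouslin c [set x | P (c x i)].
Proof.
split; first by rewrite -[X in Souslin _ X]setTI; exact: Souslin_cylinder.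
have -> : ~` [set x | P (c x i)] = setT `&` [set x | (~` P) (c x i)].
  by rewrite setTI.
exact: Souslin_cylinder.
Qed.

Lemma biSouslinT : biSouslin c setT.
Proof. by split; rewrite ?setCT//; exact: Souslin0. Qed.

Lemma sigma_algebra_biSouslin : sigma_algebra setT (biSouslin c).
Proof.
split; first by rewrite -setCT; apply: biSouslinC; exact: biSouslinT.
  by move=> A; rewrite setTD; exact: biSouslinC.
exact: biSouslinU.
Qed.

Lemma biSouslin_const (Q : Prop) : biSouslin c [set x | Q].
Proof. exact: (@biSouslin_cylinder 0%N (fun=> Q)). Qed.

Lemma biSouslin_imply (A B : set X) :
  biSouslin c A -> biSouslin c B -> biSouslin c [set x | A x -> B x].
Proof.
move=> bA bB; have -> : [set x | A x -> B x] = \bigcup_n (if n is 0 then ~` A else B).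
  apply/seteqP; split=> x /=.
    have [Ax /(_ Ax) Bx|nAx _] := pselect (A x); first by exists 1%N.
    by exists 0%N.
  by move=> [[|n] _].
by apply: biSouslinU => -[|n] //; exact: biSouslinC.
Qed.

Lemma biSouslin_and (A B : set X) :
  biSouslin c A -> biSouslin c B -> biSouslin c (A `&` B).
Proof.
move=> bA bB; have -> : A `&` B = \bigcap_n (if n is 0 then A else B).
  apply/seteqP; split=> [x [? ?] [|n] _ //|x AB].
  by split; [exact: (AB 0%N)|exact: (AB 1%N)].
by apply: biSouslinI => -[|n].
Qed.

Lemma biSouslin_forall (A : nat -> set X) :
  (forall n, biSouslin c (A n)) -> biSouslin c [set x | forall n, A n x].
Proof.
move=> bA; have -> : [set x | forall n, A n x] = \bigcap_n A n.
  by apply/seteqP; split=> [x Ax n _|x Ax n]; exact: Ax.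
exact: biSouslinI.
Qed.

Lemma biSouslin_exists (A : nat -> set X) :
  (forall n, biSouslin c (A n)) -> biSouslin c [set x | exists n, A n x].
Proof.
move=> bA; have -> : [set x | exists n, A n x] = \bigcup_n A n.
  by apply/seteqP; split=> [x [n An]|x [n _ An]]; exists n.
exact: biSouslinU.
Qed.

End sigma_algebra_biSouslin.

(** * Codes of Polish spaces, standard Borel spaces and products *)

Lemma Souslin_Baire : Souslin (@id (nat -> nat)) setT.
Proof.
exists (fun=> fun=> 0%N) => s t st; exists s; split=> //; apply/funext => i.
by have [_ _ /(_ i (mem_head _ _))[_]] := st [:: i].
Qed.

Lemma Souslin_range (X : Type) (c : X -> nat -> nat) :
  Souslin id (range c) -> Souslin c setT.
Proof.
move=> [w wc]; exists (w \o c) => s t st.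
have [l|_ [[x _ <-] cx wx]] := wc s t; last by exists x.
by have [x _ xl] := st l; exists (c x); first exists x.
Qed.

(** The base consists of the interiors of the balls of radius 1/(n+1) about the points of the dense
    set. *)
Lemma countable_base (R : realType) (T : pseudoMetricType R) (S : set T) :
  countable S -> dense S ->
  exists U : nat -> set T, (forall i, open (U i)) /\
    forall x V, nbhs x V -> exists2 i, U i x & U i `<=` V.
Proof.
move=> /countable_injP[f f_inj] dS.
(* At most one point of [S] has number k; a union over [t k] spares a partial inverse of [f]. *)
pose t k (y : T) := S y /\ f y = k.
pose U i := if pickle_inv i is Some p then
  \bigcup_(y in t p.1) (ball y p.2.+1%:R^-1%R)° else set0.
exists U; split=> [i|x V].
  rewrite /U; case: pickle_inv => [p|]; last exact: open0.
  by apply: bigcup_open => y _; exact: open_interior.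
rewrite -nbhs_ballE => -[e /= e0 eV].
have [n ne] : exists n, (n.+1%:R^-1 < e / 2 :> R)%R.
  have e2 : (0 < e / 2)%R by rewrite divr_gt0.
  by have [n _ nP] := near_infty_natSinv_lt (PosNum e2); exists n; exact: nP (leqnn n).
(* Half the radius: if y is within [r] of x, then the ball of radius [r] about x lies in the ball of
   radius 1/(n+1) about y, so x is interior to the latter. *)
pose r : R := (n.+1%:R^-1 / 2)%R.
have r0 : (0 < r)%R by rewrite divr_gt0// invr_gt0.
have rr : (r + r = n.+1%:R^-1)%R by rewrite -splitr.
have [|y [/interior_subset xy Sy]] := dS (ball x r)° _ (open_interior _).
  by exists x; exact: (open_nbhs_ball x (PosNum r0)).2.
have tE z : t (f y) z -> z = y.
  by move=> [Sz fz]; apply: f_inj; rewrite ?inE.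
exists (pickle (f y, n)); rewrite /U pickleK_inv /=.
  exists y => //; rewrite /interior -nbhs_ballE; exists r => //= z xz.
  by rewrite -rr; apply: ball_triangle xz; exact: ball_sym.
move=> z [_ /tE -> /interior_subset yz]; apply: eV.
rewrite (splitr e); apply: (@ball_triangle _ _ y).
  by apply: le_ball xy; rewrite (le_trans _ (ltW ne))// -rr lerDl ltW.
by apply: le_ball yz; rewrite ltW.
Qed.

(** A point is coded by the 0-1 sequence that tells which basic open sets contain it. The range of
    this code is described by countably many conditions on digits, so it is bi-Souslin in the Baire
    space and the whole space is Souslin. Open sets are countable unions of digit conditions, hence
    all Borel sets are bi-Souslin. *)
Lemma Polish_code (R : realType) (T : completePseudoMetricType R) (S : set T) :
  hausdorff_space T -> countable S -> dense S ->
  exists c : T -> nat -> nat, [/\ injective c,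
    forall i (P : set nat), <<s open >> [set x | P (c x i)] &
    forall A, <<s open >> A -> Souslin c A].
Proof.
move=> hT cS dS; have [U [oU bU]] := countable_base cS dS.
pose c (x : T) i : nat := `[< U i x >].
have cE x i : (c x i = 1%N) = U i x.
  by rewrite /c; apply/propext; case: asboolP.
have c_inj : injective c.
  move=> x y cxy; apply: hT => A B /bU[i Ux UA] By; exists y; split.
    by apply: UA; rewrite -cE -cxy cE.
  exact: nbhs_singleton.
exists c.
pose small n i := exists y, U i `<=` ball y (n.+1%:R^-1 : R)%R.
have sT : sigma_algebra setT (biSouslin (@id (nat -> nat))).
  by apply: sigma_algebra_biSouslin => //; exact: Souslin_Baire.
(* b is a code iff the U i with b i = 1 form the base of a Cauchy filter, and
   b i = 1 exactly when its limit lies in U i. *)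
have rangeE : range c = [set b | (forall i, b i = 0%N \/ b i = 1%N) /\
   ((forall n, exists i, b i = 1%N /\ small n i) /\
   ((forall i, b i = 1%N -> exists j, b j = 1%N /\ closure (U j) `<=` U i) /\
   ((forall i, b i = 1%N -> U i !=set0) /\
   ((forall i j, b i = 1%N -> b j = 1%N ->
      exists k, b k = 1%N /\ U k `<=` U i `&` U j) /\
   (forall i j, b j = 1%N -> U j `<=` U i -> b i = 1%N)))))].
  apply/seteqP; split=> [_ [x _ <-]|b].
    split; first by move=> i; rewrite /c; case: asboolP; [right|left].
    split.
      move=> n; have [|i Ux Ui] := bU x (ball x (n.+1%:R^-1)%R).
        by apply: nbhsx_ballx; rewrite invr_gt0.
      by exists i; rewrite cE; split=> //; exists x.
    split.
      move=> i; rewrite cE => Ux.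
      have /uniform_regular [V xV VU] : nbhs x (U i) by apply: open_nbhs_nbhs.
      have [j Uj jV] := bU x V xV; exists j; rewrite cE; split=> //.
      by apply: subset_trans VU; exact: closure_subset.
    split; first by move=> i; rewrite cE => Ux; exists x.
    split.
      move=> i j; rewrite !cE => Ui Uj.
      have [|k Uk kij] := bU x (U i `&` U j).
        by apply: filterI; apply: open_nbhs_nbhs.
      by exists k; rewrite cE.
    by move=> i j; rewrite !cE => Uj; apply.
  move=> [b01 [bs [br [b0 [bI bS]]]]].
  pose G : set_system T := [set V | exists i, b i = 1%N /\ U i `<=` V].
  have PG : ProperFilter G.
    split.
      by move=> [i [/b0[x Ux] /(_ _ Ux)]].
    split.
    - by have [i [bi _]] := bs 0%N; exists i.
    - move=> V W [i [bi iV]] [j [bj jW]].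
      have [k [bk kij]] := bI _ _ bi bj; exists k; split=> // x /kij[? ?].
      by split; [exact: iV|exact: jW].
    - by move=> V W VW [i [bi iV]]; exists i; split=> //; exact: subset_trans VW.
  have /cauchy_cvg : cauchy G.
    apply: cauchy_exP => e e0.
    have [n _ nP] := near_infty_natSinv_lt (PosNum e0).
    have [i [bi [y iy]]] := bs n; exists y, i; split=> // z /iy.
    by apply: le_ball; rewrite ltW//; exact: nP (leqnn n).
  set x := lim _ => Gx.
  exists x => //; apply/funext => i.
  have [bi|bi] := b01 i; rewrite bi; last first.
    rewrite cE; have [j [bj ji]] := br _ bi; apply: ji => V /Gx[k [bk kV]].
    have [l [bl lI]] := bI _ _ bj bk; have [z /lI[? ?]] := b0 _ bl.
    by exists z; split=> //; exact: kV.
  rewrite /c asboolF// => Ux.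
  have /Gx[j [bj ji]] : nbhs x (U i) by apply: open_nbhs_nbhs.
  by have := bS _ _ bj ji; rewrite bi.
have cT : Souslin c setT.
  apply: Souslin_range; suff: biSouslin id (range c) by case.
  have cyl i P : biSouslin id [set b : nat -> nat | P (b i)].
    by apply: biSouslin_cylinder; exact: Souslin_Baire.
  have one i : biSouslin id [set b : nat -> nat | b i = 1%N].
    exact: (cyl _ (fun k => k = 1%N)).
  have cst Q : biSouslin id [set b : nat -> nat | Q].
    by apply: biSouslin_const; exact: Souslin_Baire.
  rewrite rangeE; do !apply: biSouslin_and => //;
    do !(apply: biSouslin_forall => // ?).
  - exact: (cyl _ (fun k => k = 0%N \/ k = 1%N)).
  - apply: biSouslin_exists => // i.
    by apply: biSouslin_and => //; [exact: one|exact: cst].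
  - apply: biSouslin_imply => //; first exact: one.
    apply: biSouslin_exists => // i.
    by apply: biSouslin_and => //; [exact: one|exact: cst].
  - by apply: biSouslin_imply => //; [exact: one|exact: cst].
  - do 2 (apply: biSouslin_imply => //; first exact: one).
    apply: biSouslin_exists => // i.
    by apply: biSouslin_and => //; [exact: one|exact: cst].
  - apply: biSouslin_imply => //; first exact: one.
    by apply: biSouslin_imply => //; [exact: cst|exact: one].
have sc : sigma_algebra setT (biSouslin c) by exact: sigma_algebra_biSouslin.
split=> //.
  move=> i P; have oi : <<s open >> (U i) by apply: sub_gen_smallest; exact: oU.
  have [s0 sC sU] := smallest_sigma_algebra setT (@open T).
  have sI (A B : set T) : <<s open >> A -> <<s open >> B -> <<s open >> (A `|` B).
    by move=> sA sB; rewrite -bigcup2E; apply: sU => -[|[|n]].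
  have -> : [set x | P (c x i)] =
    (U i `&` [set x | P 1%N]) `|` ((setT `\` U i) `&` [set x | P 0%N]).
    apply/seteqP; split=> x /=; rewrite /c; case: asboolP => [Ux|nUx] //=.
    - by move=> ?; left.
    - by move=> ?; right.
    - by move=> [[]//|[[]]].
    - by move=> [[]//|[]].
  have H (A : set T) Q : <<s open >> A -> <<s open >> (A `&` [set _ | Q]).
    move=> sA; have [q|nq] := pselect Q.
      by rewrite (_ : _ `&` _ = A)//; apply/seteqP; split=> // x [].
    by rewrite (_ : _ `&` _ = set0)//; apply/seteqP; split=> // x [].
  by apply: sI; apply: H => //; exact: sC.
move=> A sA; suff: biSouslin c A by case.
move: A sA; apply: smallest_sub => // A oA.
have -> : A = [set x | exists i, [set y | U i `<=` A /\ c y i = 1%N] x].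
  apply/seteqP; split=> [x Ax|x [i /= [iA]]].
    have [i Ui iA] := bU x A (open_nbhs_nbhs (conj oA Ax)).
    by exists i; rewrite /= cE.
  by rewrite cE; exact: iA.
apply: biSouslin_exists => // i; apply: biSouslin_and => //.
  exact: biSouslin_const.
exact: (@biSouslin_cylinder _ _ cT _ (fun k => k = 1%N)).
Qed.
(** All that is used below of a standard Borel space. *)
Definition coded (d : measure_display) (X : measurableType d)
    (c : X -> nat -> nat) : Prop :=
  [/\ injective c, forall i (P : set nat), measurable [set x | P (c x i)] &
      forall A, measurable A -> Souslin c A].

Lemma standard_borel_coded (R : realType) (d : measure_display)
    (J : measurableType d) :
  standard_borel R J -> exists c : J -> nat -> nat, coded c.
Proof.
move=> [T [f [hT [S cS dS] [g fK gK] mE]]].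
have [c [c_inj mc sc]] := Polish_code hT cS dS.
exists (c \o f); split.
- by move=> x y /c_inj /(can_inj fK).
- by move=> i P; apply/mE; exists [set x | P (c x i)].
- move=> A /mE[B /sc[w wB] ->]; exists (w \o f) => s t st.
  have [l|y [By cy wy]] := wB s t; last by exists (g y); rewrite /= gK.
  by have [x Bx xl] := st l; exists (f x).
Qed.

Definition interleave (s t : nat -> nat) : nat -> nat :=
  fun i => if odd i then t i./2 else s i./2.

Lemma interleave_even s t i : interleave s t i.*2 = s i.
Proof. by rewrite /interleave odd_double doubleK. Qed.

Lemma interleave_odd s t i : interleave s t i.*2.+1 = t i.
Proof. by rewrite /interleave /= odd_double /= uphalf_double. Qed.

Definition prod_code (X Y : Type) (c : X -> nat -> nat) (c' : Y -> nat -> nat)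
  (p : X * Y) := interleave (c p.1) (c' p.2).

(** Codes of rectangles are interleaved. The complement of a rectangle is a disjoint union of two
    rectangles, so the generators of the product sigma-algebra are bi-Souslin. *)
Lemma coded_prod (d d' : measure_display) (X : measurableType d)
    (Y : measurableType d') (c : X -> nat -> nat) (c' : Y -> nat -> nat) :
  coded c -> coded c' -> coded (prod_code c c').
Proof.
move=> [ci mc sc] [ci' mc' sc'].
have inj : injective (prod_code c c').
  move=> [x y] [x' y'] e; congr pair.
    apply: ci; apply/funext => i; have := congr1 (@^~ i.*2) e.
    by rewrite /prod_code !interleave_even.
  apply: ci'; apply/funext => i; have := congr1 (@^~ i.*2.+1) e.
  by rewrite /prod_code !interleave_odd.
have sX A B : Souslin c A -> Souslin c' B ->
    Souslin (prod_code c c') (A `*` B).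
  move=> [w wA] [w' wB].
  exists (fun p => interleave (w p.1) (w' p.2)) => s t st.
  have [l|x [Ax cx wx]] := wA (fun i => s i.*2) (fun i => t i.*2).
    have [[x y] /= [Ax By] xl] := st (map double l); exists x => // i il.
    have := xl i.*2 (map_f double il).
    by rewrite /prod_code !interleave_even.
  have [l|y [By cy wy]] := wB (fun i => s i.*2.+1) (fun i => t i.*2.+1).
    have [[x' y] /= [Ax' By] xl] := st (map (fun i => i.*2.+1) l).
    exists y => // i il.
    have := xl i.*2.+1 (map_f (fun i => i.*2.+1) il).
    by rewrite /prod_code !interleave_odd.
  exists (x, y); split=> //; apply/funext => i;
    rewrite /prod_code /interleave /=; case: ifPn => oi.
  - by rewrite cy -[in RHS](odd_double_half i) oi.
  - by rewrite cx -[in RHS](odd_double_half i) (negbTE oi).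
  - by rewrite wy -[in RHS](odd_double_half i) oi.
  - by rewrite wx -[in RHS](odd_double_half i) (negbTE oi).
have sT : Souslin (prod_code c c') setT.
  by rewrite -setXTT; apply: sX; [apply: sc|apply: sc'].
split=> //.
- move=> i P; rewrite /prod_code /interleave; case oi : (odd i).
    rewrite (_ : [set _ | _] = setT `*` [set y | P (c' y i./2)]).
      exact: measurableX.
    by apply/seteqP; split=> [[x y] //= ?|[x y] []//].
  rewrite (_ : [set _ | _] = [set x | P (c x i./2)] `*` setT).
    exact: measurableX.
  by apply/seteqP; split=> [[x y] //= ?|[x y] []//].
- move=> A; rewrite measurable_prod_measurableType => mA.
  suff: biSouslin (prod_code c c') A by case.
  move: A mA; apply: smallest_sub; first exact: sigma_algebra_biSouslin.
  move=> _ [A mA [B mB <-]]; split; first by apply: sX; [exact: sc|exact: sc'].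
  have -> : ~` (A `*` B) =
      \bigcup_n (if n is 0 then ~` A `*` setT else
                 if n is 1 then A `*` ~` B else set0).
    apply/seteqP; split=> [[x y] /= nAB|[x y]].
      have [Ax|nAx] := pselect (A x); last by exists 0%N.
      by exists 1%N => //; split=> // By; exact: nAB.
    by move=> [[|[|n]] _ //= []] nA nB [].
  apply: SouslinU_disjoint.
    move=> [|[|n]]; last exact: Souslin0.
      by apply: sX; [apply: sc; exact: measurableC|apply: sc'].
    by apply: sX; [exact: sc|apply: sc'; exact: measurableC].
  by move=> [|[|m]] [|[|n]] _ _ // -[p pI]; exfalso; move: pI => /= -[] /=; tauto.
Qed.

(** * Separation and the Lusin-Novikov theorem *)

Section separation.
Variables (d d' : measure_display) (X : measurableType d).
Variables (Y : measurableType d') (c : X -> nat -> nat) (c' : Y -> nat -> nat).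
Hypothesis cY : coded c'.
Variables (f : X -> Y) (r : nat -> nat).
(** A strong form of continuity: each digit of the image is copied from a digit of the argument. The
    first projection has it for interleaved codes, with [r] the doubling map. *)
Hypothesis fr : forall x i, c' (f x) i = c x (r i).

Definition separated (P : nat -> set Y) : Prop :=
  exists B : nat -> set Y, [/\ forall n, measurable (B n),
    forall n, P n `<=` B n & \bigcap_n B n = set0].

(** The hulls for the various pieces are united at index i and intersected at all others. Read
    contrapositively, an inseparable family stays inseparable when its i-th set is replaced by a
    suitable piece. *)
Lemma separated_bigcup (P : nat -> set Y) (i : nat) (K : countType)
    (Q : K -> set Y) : K ->
  P i `<=` \bigcup_a Q a ->
  (forall a, separated (fun n => if n == i then Q a else P n)) -> separated P.
Proof.
move=> a0 PQ /choice[B Bh].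
pose e k := odflt a0 (unpickle k).
have eK a : e (pickle a) = a by rewrite /e pickleK.
exists (fun n => if n == i then \bigcup_k B (e k) n else \bigcap_k B (e k) n).
split=> [n|n|].
- case: ifP => _; [apply: bigcup_measurable|apply: bigcap_measurable] => // k _.
    by have [] := Bh (e k).
  by have [] := Bh (e k).
- case: eqP => [->|/eqP/negbTE ni].
    move=> x /PQ[a _ Qx]; exists (pickle a) => //; rewrite eK.
    by have [_ /(_ i)] := Bh a; rewrite eqxx => + _; apply.
  move=> x Px k _; have [_ /(_ n)] := Bh (e k).
  by rewrite ni => + _; apply.
- apply/seteqP; split=> // x xB.
  have := xB i I; rewrite eqxx => -[k _ xk].
  have [_ _ <-] := Bh (e k); move=> n _; have := xB n I.
  by case: eqP => [->//|_]; exact.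
Qed.

Let node := (nat * nat)%type.

(* Novikov's separation theorem: if no Borel separation existed, one could
   refine the codes of the sets one digit at a time, keeping the family
   inseparable; the limiting codes name points of the A n whose images
   coincide, since distinct images are separated by a cylinder. *)
Lemma Novikov_separation (A : nat -> set X) : (forall n, Souslin c (A n)) ->
  \bigcap_n (f @` A n) = set0 -> separated (fun n => f @` A n).
Proof.
move=> /choice[w wA] A0; have [ci' mc' _] := cY.
pose Z n (s : seq node) := [set x | A n x /\
  forall i, (i < size s)%N -> (c x i, w n x i) = nth (0, 0)%N s i].
pose P (q : nat -> seq node) n := f @` Z n (q n).
apply: contrapT => nsep.
have step (q : {q | ~ separated (P q)}) i : {a | ~ separated
    (P (fun n => if n == i then rcons (sval q i) a else sval q n))}.
  apply: cid; case: q => q /= nq; apply: contrapT => h; apply: nq.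
  apply: (@separated_bigcup _ i node (fun a => f @` Z i (rcons (q i) a))).
  - exact: (0, 0)%N.
  - move=> _ [x [Ax xq] <-].
    exists (c x (size (q i)), w i x (size (q i))) => //; exists x => //.
    split=> // j; rewrite size_rcons ltnS nth_rcons leq_eqVlt.
    by case: ltngtP => //= [/xq//|-> _].
  - move=> a; apply: contrapT => na; apply: h; exists a => sq; apply: na.
    by congr separated: sq; apply/funext => n; rewrite /P; case: eqP => // ->.
have q0 : ~ separated (P (fun=> [::])).
  congr (~ separated _) : nsep; apply/funext => n; rewrite /P.
  by congr image; apply/seteqP; split=> [x Ax|x [Ax _]]; rewrite /Z.
(* Step t lengthens the prefix of the set with index [logn 2 t]. Every n is this exponent for
   arbitrarily large t, so all prefixes grow without bound. *)
pose next t q : {q | ~ separated (P q)} :=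
  exist (fun q => ~ separated (P q)) _ (svalP (step q (logn 2 t))).
pose fix q t := if t is t'.+1 then next t' (q t') else
  exist (fun q => ~ separated (P q)) _ q0.
pose Q t n := sval (q t) n.
have Qsep t : ~ separated (P (Q t)) by exact: svalP (q t).
have QS t n : exists a, Q t.+1 n = if n == logn 2 t then rcons (Q t n) a else Q t n.
  by rewrite /Q /=; case: (step _ _) => a _ /=; exists a; case: eqP => // ->.
have QS_nth t n j : (j < size (Q t n))%N -> (j < size (Q t.+1 n))%N /\
    nth (0, 0)%N (Q t.+1 n) j = nth (0, 0)%N (Q t n) j.
  move=> jt; have [a ->] := QS t n; case: ifP => // _.
  by rewrite size_rcons ltnS (ltnW jt) nth_rcons jt.
have Qnth t t' n j : (t <= t')%N -> (j < size (Q t n))%N ->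
    (j < size (Q t' n))%N /\ nth (0, 0)%N (Q t' n) j = nth (0, 0)%N (Q t n) j.
  move=> /subnKC <-; elim: (t' - t)%N => [|k IH] jt; first by rewrite addn0.
  have [jk <-] := IH jt; rewrite addnS; exact: QS_nth.
have Qsz n m : exists t, (m <= size (Q t n))%N.
  elim: m => [|m [t mt]]; first by exists 0%N.
  (* A time not before t at which the prefix with index n is lengthened: the exponent of 2 in it is
     n. *)
  pose t' := (2 ^ n * t.*2.+1)%N.
  have tt' : (t <= t')%N.
    apply: (@leq_trans t.*2.+1); first by rewrite -addnn ltnW// ltnS leq_addr.
    by rewrite leq_pmull// expn_gt0.
  have lt' : logn 2 t' = n.
    rewrite lognM ?expn_gt0// pfactorK// logn_coprime ?addn0//.
    by rewrite coprime2n /= odd_double.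
  exists t'.+1; have [a ->] := QS t' n; rewrite lt' eqxx size_rcons ltnS.
  case: m mt => // m mt; exact: (Qnth _ _ _ _ tt' mt).1.
have [T hT] := choice (fun nm : nat * nat => Qsz nm.1 nm.2).
pose s n j := nth (0, 0)%N (Q (T (n, j.+1)) n) j.
have sE t n j : (j < size (Q t n))%N -> nth (0, 0)%N (Q t n) j = s n j.
  move=> jt; have jT := hT (n, j.+1).
  have [tT|/ltnW tT] := leqP t (T (n, j.+1)).
    by rewrite /s (Qnth _ _ _ _ tT jt).2.
  by rewrite /s (Qnth _ _ _ _ tT jT).2.
have Q0 t n : exists x, Z n (Q t n) x.
  apply: contrapT => nx; apply: (Qsep t).
  exists (fun m => if m == n then set0 else setT); split=> [m|m|].
  - by case: ifP.
  - by case: eqP => // -> y [x Zx _]; apply: nx; exists x.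
  - by apply/seteqP; split=> // x /(_ n I); rewrite eqxx.
have hx n : exists x, A n x /\ forall i, (c x i, w n x i) = s n i.
  have [l|x [Ax cx wx]] := wA n (fst \o s n) (snd \o s n).
    have [t lt] := Qsz n (\max_(i <- l) i).+1.
    have [x [Ax Zx]] := Q0 t n; exists x => // i il.
    have it : (i < size (Q t n))%N.
      by apply: leq_trans lt; rewrite ltnS leq_bigmax_seq.
    by have := Zx _ it; rewrite (sE t)//= => <-.
  by exists x; split=> // i; rewrite cx wx /= -surjective_pairing.
have [x xP] := choice hx.
suff fx n : f (x n) = f (x 0%N).
  have : (\bigcap_n (f @` A n)) (f (x 0%N)).
    by move=> n _; rewrite -(fx n); exists (x n) => //; exact: (xP n).1.
  by rewrite A0.
apply: contrapT => fn.
have [i ni] : exists i, c' (f (x n)) i <> c' (f (x 0%N)) i.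
  apply: contrapT => h; apply: fn; apply: ci'; apply/funext => i.
  by apply: contrapT => ni; apply: h; exists i.
(* Both prefixes have to reach position [r i], which determines digit i of the image. *)
have [t1 ht1] := Qsz n (r i).+1; have [t2 ht2] := Qsz 0%N (r i).+1.
pose t := maxn t1 t2.
have {}ht1 := (Qnth _ _ _ _ (leq_maxl t1 t2) ht1).1.
have {}ht2 := (Qnth _ _ _ _ (leq_maxr t1 t2) ht2).1.
apply: (Qsep t).
exists (fun m => if m == n then [set y | c' y i = c' (f (x n)) i] else
  if m == 0%N then [set y | c' y i = c' (f (x 0%N)) i] else setT).
have PB m : (r i < size (Q t m))%N ->
    P (Q t) m `<=` [set y | c' y i = c' (f (x m)) i].
  move=> hm _ [y [_ /(_ _ hm) + ] <-] /=; rewrite (sE t)// -(xP m).2 !fr.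
  by case.
split=> [m|m|].
- case: ifP => _; first exact: (mc' _ (fun k => k = _)).
  by case: ifP => _; first exact: (mc' _ (fun k => k = _)).
- by case: eqP => [->|_]; [exact: PB|case: eqP => // ->; exact: PB].
- apply/seteqP; split=> // y yB; apply: ni.
  have := yB n I; rewrite eqxx /= => <-.
  have := yB 0%N I; rewrite eqxx; case: eqP => // n0.
  by exfalso; apply: fn; rewrite -n0.
Qed.

End separation.

(** * Measurability of sets given by countable formulas *)

Section measurable_prop.
Variables (d : measure_display) (Z : measurableType d).

Lemma measurable_conj (P Q : Z -> Prop) : measurable [set z | P z] ->
  measurable [set z | Q z] -> measurable [set z | P z /\ Q z].
Proof. exact: measurableI. Qed.

Lemma measurable_negP (P : Z -> Prop) : measurable [set z | P z] ->
  measurable [set z | ~ P z].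
Proof. exact: measurableC. Qed.

Lemma measurable_imp (P Q : Z -> Prop) : measurable [set z | P z] ->
  measurable [set z | Q z] -> measurable [set z | P z -> Q z].
Proof.
move=> mP mQ; rewrite (_ : [set z | P z -> Q z] = ~` [set z | P z] `|` [set z | Q z]).
  by apply: measurableU => //; exact: measurableC.
apply/seteqP; split=> z /= => [PQ|[nP /nP//|//]].
by have [/PQ|] := pselect (P z); [right|left].
Qed.

Lemma measurable_cstP (P : Prop) : measurable [set z : Z | P].
Proof.
have [p|np] := pselect P.
  by rewrite (_ : [set _ | _] = setT)//; apply/seteqP; split.
by rewrite (_ : [set _ | _] = set0)//; apply/seteqP; split.
Qed.

Lemma measurable_ex (I : countType) (P : I -> Z -> Prop) :
  (forall i, measurable [set z | P i z]) -> measurable [set z | exists i, P i z].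
Proof.
move=> mP; rewrite (_ : [set _ | _] = \bigcup_i [set z | P i z]).
  apply: countable_bigcupT_measurable; last exact: mP.
  exact: countableP.
by apply/seteqP; split=> [z [i Pi]|z [i _ Pi]]; exists i.
Qed.

Lemma measurable_all (I : countType) (P : I -> Z -> Prop) :
  (forall i, measurable [set z | P i z]) -> measurable [set z | forall i, P i z].
Proof.
move=> mP; rewrite (_ : [set _ | _] = ~` [set z | exists i, ~ P i z]).
  by apply: measurableC; apply: measurable_ex => i; exact: measurable_negP.
apply/seteqP; split=> [z Pz [i]|z nP i]; first by apply; exact: Pz.
by apply: contrapT => nPi; apply: nP; exists i.
Qed.

Lemma measurable_preim (d' : measure_display) (Y : measurableType d')
    (f : Z -> Y) (A : set Y) :
  measurable_fun setT f -> measurable A -> measurable [set z | A (f z)].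
Proof. by move=> mf mA; rewrite -[X in measurable X]setTI; exact: mf. Qed.

(** Points are equal when all their digits are, a countable conjunction of measurable conditions. *)
Lemma measurable_coded_eq (d' : measure_display) (Y : measurableType d')
    (c : Y -> nat -> nat) (f g : Z -> Y) : coded c ->
  measurable_fun setT f -> measurable_fun setT g ->
  measurable [set z | f z = g z].
Proof.
move=> [ci mc _] mf mg.
rewrite (_ : [set _ | _] =
    [set z | forall i, exists a, c (f z) i = a /\ c (g z) i = a]).
  apply: measurable_all => i; apply: measurable_ex => a.
  have ma := mc i (fun k => k = a).
  by apply: measurable_conj;
    [exact: (measurable_preim mf ma)|exact: (measurable_preim mg ma)].
apply/seteqP; split=> z /= => [-> i|fg]; first by exists (c (g z) i).
by apply: ci; apply/funext => i; have [a [-> ->]] := fg i.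
Qed.

End measurable_prop.

(** * Injective images of Borel sets and enumeration of finite sections *)

Section LusinSouslin.
Variables (d d' : measure_display) (X : measurableType d).
Variables (Y : measurableType d') (c : X -> nat -> nat) (c' : Y -> nat -> nat).
Hypotheses (cX : coded c) (cY : coded c').
Variables (f : X -> Y) (r : nat -> nat).
Hypothesis fr : forall x i, c' (f x) i = c x (r i).

(** Novikov separation for the family A, B, B, ...: a point of the first hull that lies in the image
    of [B] would lie in all the hulls. *)
Lemma Lusin_separation (A B : set X) : Souslin c A -> Souslin c B ->
  (f @` A) `&` (f @` B) = set0 ->
  exists C, [/\ measurable C, f @` A `<=` C & C `&` (f @` B) = set0].
Proof.
move=> sA sB AB.
have [||D [mD AD D0]] := Novikov_separation cY fr
    (A := fun n => if n is 0 then A else B); first by case.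
  rewrite -subset0 => x h; rewrite -AB.
  by split; [exact: (h 0%N)|exact: (h 1%N)].
exists (D 0%N); split; [exact: mD|exact: (AD 0%N)|].
rewrite -subset0 => x [x0 xB]; rewrite -D0 => -[|n] _ //.
exact: (AD n.+1).
Qed.

(* The images of the pieces Z s of A given by the length-n prefixes s of the
   codes are disjoint, hence contained in disjoint Borel sets D s; f @` A is the
   set of the points that lie in D s for prefixes s of every length. *)
Theorem Lusin_Souslin (A : set X) : measurable A ->
  {in A &, injective f} -> measurable (f @` A).
Proof.
move=> mA fI; have [ci mc sc] := cX; have [ci' mc' _] := cY.
have [w wA] := sc _ mA.
pose z x i := (c x i, w x i).
pose Z (s : seq (nat * nat)) := [set x | A x /\
  forall i, (i < size s)%N -> z x i = nth (0, 0)%N s i].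
have sZ s : Souslin c (Z s).
  exists w => u v uv; have [l|x [Ax cx wx]] := wA u v.
    by have [x [Ax _] xl] := uv l; exists x.
  exists x; split=> //; split=> // i si.
  have [y [_ /(_ _ si) <-] /(_ i (mem_head _ _))[yu yv]] := uv [:: i].
  by rewrite /z cx wx yu yv.
have disj (st : seq (nat * nat) * seq (nat * nat)) : exists C,
    size st.1 = size st.2 -> st.1 <> st.2 ->
    [/\ measurable C, f @` Z st.1 `<=` C & C `&` (f @` Z st.2) = set0].
  case: st => s t /=; have [ss|ns] := pselect (size s = size t /\ s <> t).
    have [|C CP] := Lusin_separation (sZ s) (sZ t); last by exists C.
    rewrite -subset0 => _ [[x [Ax xs] <-] [y [Ay yt] xy]]; case: ss => ss; apply.
    have {}xy : y = x by apply: fI; rewrite ?inE.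
    apply: (@eq_from_nth _ (0, 0)%N) => // i si.
    by rewrite -xs// -yt ?xy// -ss.
  by exists set0 => ss nst; exfalso; apply: ns.
have [C CP] := choice disj.
(* The prefix s is realised in [A], it agrees with the digits of y that it determines, and y lies on
   the side of s against every other prefix of the same length. The last clause makes the sets [D s]
   of one length disjoint. *)
pose D s := [set y | (exists x, Z s x) /\
  (forall i, (r i < size s)%N -> c' y i = (nth (0, 0)%N s (r i)).1) /\
  (forall t, size s = size t -> s <> t -> C (s, t) y /\ ~ C (t, s) y)].
have mD s : measurable (D s).
  apply: measurable_conj; first exact: measurable_cstP.
  apply: measurable_conj.
    apply: measurable_all => i; apply: measurable_imp.
      exact: measurable_cstP.
    exact: (mc' i (fun k => k = _)).
  apply: measurable_all => t.
  have [ss|ss] := pselect (size s = size t); last first.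
    by rewrite (_ : [set _ | _] = setT)//; apply/seteqP; split=> // y _ ts; case: ss.
  have [st|st] := pselect (s <> t); last first.
    by rewrite (_ : [set _ | _] = setT)//; apply/seteqP; split=> // y _ _ /st.
  rewrite (_ : [set _ | _] = C (s, t) `&` ~` C (t, s)).
    apply: measurableI; first by have [] := CP (s, t) ss st.
    by apply: measurableC; have [] := CP (t, s) (esym ss) (nesym st).
  by apply/seteqP; split=> [y h|y h _ _]; [exact: (h ss st)|exact: h].
have D_uniq s t y : size s = size t -> D s y -> D t y -> s = t.
  move=> ss [_ [_ Ds]] [_ [_ Dt]]; apply: contrapT => st.
  by have [_] := Dt s (esym ss) (nesym st); have [] := Ds t ss st.
rewrite (_ : f @` A = [set y | forall n, exists s, size s = n /\
    forall k, (k <= n)%N -> D (take k s) y]).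
  apply: measurable_all => n; apply: measurable_ex => s.
  apply: measurable_conj; first exact: measurable_cstP.
  apply: measurable_all => k; apply: measurable_imp.
    exact: measurable_cstP.
  exact: mD.
apply/seteqP; split=> [_ [x Ax <-] n|y /choice[s sP]].
  exists (mkseq (z x) n); rewrite size_mkseq; split=> // k kn.
  have -> : take k (mkseq (z x) n) = mkseq (z x) k.
    by rewrite /mkseq -map_take take_iota (minn_idPl kn).
  have Zx : Z (mkseq (z x) k) x.
    by split=> // i; rewrite size_mkseq => ik; rewrite nth_mkseq.
  split; first by exists x.
  split; first by move=> i; rewrite size_mkseq => ik; rewrite nth_mkseq// fr.
  move=> t st nst; have [_ h _] := CP (mkseq (z x) k, t) st nst.
  split; first by apply: h; exists x.
  have [_ _ /seteqP[h' _]] := CP (t, mkseq (z x) k) (esym st) (nesym nst).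
  by move=> Ctx; apply: (h' (f x)); split=> //; exists x.
have sz n : size (s n) = n by have [] := sP n.
have Ds n k : (k <= n)%N -> D (take k (s n)) y by move=> kn; exact: (sP n).2.
(* By disjointness at each length the prefixes [s n] are nested, hence initial segments of the
   single sequence [u]. *)
pose u i := nth (0, 0)%N (s i.+1) i.
have su n i : (i < n)%N -> nth (0, 0)%N (s n) i = u i.
  move=> i_n; rewrite /u; have -> : s i.+1 = take i.+1 (s n).
    apply: (@D_uniq _ _ y); rewrite ?sz ?size_takel ?sz//; last exact: Ds.
    by have := Ds i.+1 i.+1 (leqnn _); rewrite take_oversize ?sz.
  by rewrite nth_take.
have Dsn n : D (s n) y by have := Ds n n (leqnn _); rewrite take_oversize ?sz.
have [l|x [Ax cx wx]] := wA (fst \o u) (snd \o u).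
  have [[x [Ax xs]] _] := Dsn (\max_(i <- l) i).+1.
  exists x => // i il; have im : (i < (\max_(i <- l) i).+1)%N.
    by rewrite ltnS leq_bigmax_seq.
  by have := xs i; rewrite sz => /(_ im); rewrite su//= => <-.
exists x => //; apply: ci'; apply/funext => i; rewrite fr cx.
have [_ [h _]] := Dsn (r i).+1.
by rewrite h ?sz// su.
Qed.

End LusinSouslin.

Lemma measurable_fst_image (d d' : measure_display) (X : measurableType d)
    (Y : measurableType d') (c : X -> nat -> nat) (c' : Y -> nat -> nat)
    (S : set (X * Y)) : coded c -> coded c' -> measurable S ->
  {in S &, injective fst} -> measurable (fst @` S).
Proof.
move=> cX cY mS inj.
apply: (Lusin_Souslin (coded_prod cX cY) cX (r := double)) => // p i.
by rewrite /prod_code interleave_even.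
Qed.

(* A n is the set of the points of E that share the first n digits of their
   second component with another point of the same section.  Sections being
   finite, the A n have no common point; outside a Borel hull B n of A n, a
   section has at most one point in each cylinder of length n. *)
Theorem Lusin_Novikov (d : measure_display) (J : measurableType d)
    (c : J -> nat -> nat) (E : set (J * J)) : coded c -> measurable E ->
    (forall x, finite_set (xsection E x)) ->
  exists (g : nat -> J -> J) (Q : nat -> set J),
    [/\ forall k, measurable_fun setT (g k), forall k, measurable (Q k),
        forall x y, E (x, y) <-> exists2 k, Q k x & g k x = y &
        forall x j k, Q j x -> Q k x -> g j x = g k x -> j = k].
Proof.
move=> cJ mE fE; have [ci mc sc] := cJ.
pose A n : set (J * J * J) := [set p | [/\ E p.1, E (p.1.1, p.2),
  p.1.2 <> p.2 & forall i, (i < n)%N -> c p.1.2 i = c p.2 i]].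
have m2 : measurable_fun [set: J * J * J] (fun p => p.2) by exact: measurable_snd.
have m1 : measurable_fun [set: J * J * J] (fun p => p.1) by exact: measurable_fst.
have m11 : measurable_fun [set: J * J * J] (fun p => p.1.1).
  by apply: measurableT_comp m1; exact: measurable_fst.
have m12 : measurable_fun [set: J * J * J] (fun p => p.1.2).
  by apply: measurableT_comp m1; exact: measurable_snd.
have mA n : measurable (A n).
  rewrite (_ : A n = [set p | E p.1 /\ (E (p.1.1, p.2) /\ (p.1.2 <> p.2 /\
      forall i, (i < n)%N -> exists a, c p.1.2 i = a /\ c p.2 i = a))]).
    apply: measurable_conj; first exact: (measurable_preim m1).
    apply: measurable_conj.
      by apply: (@measurable_preim _ _ _ _ (fun p : J * J * J => (p.1.1, p.2))) => //;
        exact: measurable_fun_pair.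
    apply: measurable_conj.
      by apply: measurable_negP; exact: measurable_coded_eq cJ _ _.
    apply: measurable_all => i; apply: measurable_imp.
      exact: measurable_cstP.
    apply: measurable_ex => a; apply: measurable_conj.
      exact: (measurable_preim m12 (mc i (fun k => k = a))).
    exact: (measurable_preim m2 (mc i (fun k => k = a))).
  apply/seteqP; split=> p /=.
    move=> [Ep Ep' np h]; do !split=> //; move=> i /h <-.
    by exists (c p.1.2 i).
  move=> [Ep [Ep' [np h]]]; split=> // i /h[a [-> ->]] //.
have sA n : Souslin (prod_code (prod_code c c) c) (A n).
  have [_ _] := coded_prod (coded_prod cJ cJ) cJ; exact.
have A0 : \bigcap_n (fst @` A n) = set0.
  rewrite -subset0 => -[x y] Axy /=.
  have Exy : E (x, y) by have [p [+ _ _ _] <-] := Axy 0%N I.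
  have [s sE] := (finite_seqP _).1 (fE x).
  have /choice[m mP] : forall y', exists m, y <> y' -> c y m <> c y' m.
    move=> y'.
    apply: contrapT => h.
    have h' i : y <> y' /\ c y i = c y' i.
      split; first by move=> yy; apply: h; exists 0%N.
      by apply: contrapT => ni; apply: h; exists i.
    by apply: (h' 0%N).1; apply: ci; apply/funext => i; exact: (h' i).2.
  have [[[x' y''] y'] [/= _ Exy' yy' h] [xx yy]] := Axy (\max_(y' <- s) m y').+1 I.
  subst x' y''.
  apply: (mP _ yy'); apply: h; rewrite ltnS; apply: leq_bigmax_seq => //.
  by have /seteqP[+ _] := sE; apply; rewrite xsectionE.
have [|B [mB AB B0]] := Novikov_separation (coded_prod cJ cJ) (r := double) _ sA A0.
  by move=> p i; rewrite {2}/prod_code interleave_even.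
pose S (s : seq nat) : set (J * J) := [set p | E p /\ (~ B (size s) p /\
  forall i, (i < size s)%N -> c p.2 i = nth 0%N s i)].
have mS s : measurable (S s).
  apply: measurable_conj => //; apply: measurable_conj.
    by apply: measurable_negP; exact: mB.
  apply: measurable_all => i; apply: measurable_imp.
    exact: measurable_cstP.
  exact: (measurable_preim measurable_snd (mc i (fun k => k = _))).
have SI s x y y' : S s (x, y) -> S s (x, y') -> y = y'.
  move=> [Exy [nB ys]] [Exy' [_ ys']]; apply: contrapT => yy'.
  apply: nB; apply: AB; exists (x, y, y') => //; split=> // i si /=.
  by rewrite ys// ys'.
have SE x y : E (x, y) -> exists s, S s (x, y).
  move=> Exy; have [n nB] : exists n, ~ B n (x, y).
    apply: contrapT => h; have /seteqP[+ _] := B0; move=> /(_ (x, y)); apply.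
    by move=> n _; apply: contrapT => nB; apply: h; exists n.
  exists (mkseq (c y) n); rewrite /S /= size_mkseq; split=> //; split=> // i ni.
  by rewrite nth_mkseq.
pose P s x := exists y, S s (x, y).
(* Off its domain [P s] the function is the identity, which keeps it Borel. *)
pose G s x := if pselect (P s x) is left h then sval (cid h) else x.
have GS s x y : S s (x, y) -> G s x = y.
  move=> Sxy; rewrite /G; case: pselect => [h|]; last by case; exists y.
  by case: cid => y' /=; move/SI; apply.
have SG s x : P s x -> S s (x, G s x).
  by move=> [y Sxy]; rewrite (GS _ _ _ Sxy).
have mPC s C : measurable C -> measurable [set x | exists y, S s (x, y) /\ C y].
  move=> mC; rewrite (_ : [set _ | _] = fst @` (S s `&` (setT `*` C))).
    apply: (measurable_fst_image cJ cJ).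
      by apply: measurableI => //; exact: measurableX.
    move=> [x y] [x' y'] /set_mem[Sxy _] /set_mem[Sxy' _] /= xx'.
    by subst x'; rewrite (SI _ _ _ _ Sxy Sxy').
  apply/seteqP; split=> x; first by move=> [y [Sxy Cy]]; exists (x, y).
  by move=> [[x' y] [Sxy [_ Cy]] /= <-]; exists y.
have mP s : measurable (P s).
  rewrite (_ : P s = [set x | exists y, S s (x, y) /\ [set: J] y]).
    exact: mPC.
  by apply/seteqP; split=> [x [y Sy]|x [y [Sy _]]]; exists y.
have mG s : measurable_fun setT (G s).
  move=> _ C mC; rewrite setTI.
  rewrite (_ : _ @^-1` _ = [set x | exists y, S s (x, y) /\ C y] `|` (C `\` P s)).
    by apply: measurableU; [exact: mPC|exact: measurableD].
  apply/seteqP; split=> x /=.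
    have [Px|nPx] := pselect (P s x).
      by left; exists (G s x); split=> //; exact: SG.
    by rewrite /G; case: pselect => // _ Cx; right.
  move=> [[y [Sy Cy]]|[Cx nPx]]; first by rewrite (GS _ _ _ Sy).
  by rewrite /G; case: pselect.
pose e k : seq nat := odflt [::] (unpickle k).
have eK s : e (pickle s) = s by rewrite /e pickleK.
(* The k-th domain drops the points at which an earlier function takes the same value, so that no
   section is listed with repetition. *)
exists (G \o e), (fun k => P (e k) `\` [set x | exists j, (j < k)%N /\
  (P (e j) x /\ G (e j) x = G (e k) x)]); split.
- by move=> k; exact: mG.
- move=> k; apply: measurableD; first exact: mP.
  apply: measurable_ex => j; apply: measurable_conj.
    exact: measurable_cstP.
  by apply: measurable_conj; [exact: mP|exact: measurable_coded_eq cJ _ _].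
- move=> x y; split=> [Exy|[k [/SG[+ _] _] <-//]].
  have [s Ssxy] := SE _ _ Exy.
  have exk : exists k, `[< P (e k) x /\ G (e k) x = y >].
    exists (pickle s); apply/asboolP; rewrite eK; split; first by exists y.
    exact: GS.
  case: (ex_minnP exk) => k /asboolP[Pk Gk] kmin; exists k => //; split=> //.
  move=> [j [jk [Pj]]]; rewrite Gk => Gj.
  by have := kmin j; rewrite leqNgt jk => /(_ (asboolT (conj Pj Gj))).
- move=> x j k [Pj nj] [Pk nk] /= Gjk; case: (ltngtP j k) => // jk; exfalso.
    by apply: nk; exists j.
  by apply: nj; exists k.
Qed.
(** * Counting in countably enumerated sets *)

Lemma counting_image (R : realType) (T U : choiceType) (f : T -> U) (A : set T) :
  {in A &, injective f} -> counting (f @` A) = counting A :> \bar R.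
Proof.
move=> fI; rewrite /counting.
have [fA|fA] := pselect (finite_set A).
  rewrite !asboolT//; last exact: finite_image.
  rewrite fset_set_image// finmap.card_in_imfset// => x y.
  by rewrite !in_fset_set//; exact: fI.
by rewrite !asboolF// (eq_finite_set (inj_card_eq fI)).
Qed.

Lemma le_counting (R : realType) (T : choiceType) (A B : set T) :
  A `<=` B -> counting A <= counting B :> \bar R.
Proof.
move=> AB; rewrite /counting; have [fB|fB] := pselect (finite_set B).
  have fA := sub_finite_set AB fB; rewrite !asboolT// lee_fin ler_nat.
  by apply: finmap.fsubset_leq_card; rewrite -fset_set_sub.
by rewrite (asboolF fB) leey.
Qed.

Lemma counting_ge1 (R : realType) (T : choiceType) (A : set T) (x : T) :
  A x -> 1 <= counting A :> \bar R.
Proof.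
move=> Ax; rewrite (_ : 1 = counting [set x] :> \bar R).
  by apply: le_counting => _ ->.
by rewrite /counting asboolT ?fset_set1 ?finmap.cardfs1.
Qed.

Lemma counting_ge0 (R : realType) (T : choiceType) (A : set T) :
  0 <= counting A :> \bar R.
Proof. by rewrite /counting; case: ifPn; rewrite ?lee_fin// lee_pinfty. Qed.

Lemma counting_fin_num (R : realType) (T : choiceType) (A : set T) :
  finite_set A <-> (counting A : \bar R) \is a fin_num.
Proof.
by rewrite /counting; split=> [fA|]; [rewrite asboolT|case: asboolP].
Qed.

Lemma counting_series (R : realType) (T : choiceType) (f : nat -> T)
    (A : set nat) : {in A &, injective f} ->
  counting (f @` A) = \sum_(k <oo) (\1_A k)%:E :> \bar R.
Proof.
by move=> fI; rewrite counting_image// counting_dirac; apply: eq_eseriesr.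
Qed.

Section enumerated.
Variables (R : realType) (d d' : measure_display) (Z : measurableType d).
Variables (J : measurableType d') (c : J -> nat -> nat).
Hypothesis cJ : coded c.

(** The indices are words because a component will be listed by walks, each described by the
    successive functions [g k] that it follows. *)
Definition enumerated (D : Z -> set J) : Prop :=
  exists (h : seq nat -> Z -> J) (P : seq nat -> set Z),
    [/\ forall s, measurable_fun setT (h s), forall s, measurable (P s) &
        forall z, D z = [set y | exists2 s, P s z & h s z = y]].

Lemma enumerated_setI (D : Z -> set J) (A : set J) : measurable A ->
  enumerated D -> enumerated (fun z => A `&` D z).
Proof.
move=> mA [h [P [mh mP DE]]].
exists h, (fun s => [set z | P s z /\ A (h s z)]); split=> //.
  move=> s; apply: measurable_conj; first exact: mP.
  exact: measurable_preim (mh s) mA.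
move=> z; rewrite DE; apply/seteqP; split=> [y [Ay [s Ps hs]]|y [s [Ps As] hs]].
  by exists s => //; split=> //; rewrite hs.
by split; [rewrite -hs|exists s].
Qed.

Lemma enumerated_measurable (D : Z -> set J) z : enumerated D ->
  measurable (D z).
Proof.
move=> [h [P [mh mP ->]]].
rewrite (_ : [set _ | _] = [set y | exists s, P s z /\ y = h s z]).
  apply: measurable_ex => s; apply: measurable_conj.
    exact: measurable_cstP.
  exact: (@measurable_coded_eq _ _ _ _ _ id (cst (h s z)) cJ).
by apply/seteqP; split=> [y [s]|y [s []]]; exists s.
Qed.

Lemma enumerated_meets (D : Z -> set J) (A : set J) : measurable A ->
  enumerated D -> measurable [set z | exists2 y, D z y & A y].
Proof.
move=> mA [h [P [mh mP DE]]].
rewrite (_ : [set _ | _] = [set z | exists s, P s z /\ A (h s z)]).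
  apply: measurable_ex => s; apply: measurable_conj; first exact: mP.
  exact: measurable_preim (mh s) mA.
apply/seteqP; split=> [z [y]|z [s [Ps As]]] /=.
  by rewrite DE => -[s Ps <-] As; exists s.
by exists (h s z) => //; rewrite DE; exists s.
Qed.

(** Keeping for each listed value only its first index turns the count into a series of indicator
    functions of measurable sets. *)
Lemma measurable_counting (D : Z -> set J) : enumerated D ->
  measurable_fun setT (fun z => @counting J R (D z)).
Proof.
move=> [h [P [mh mP DE]]].
pose e k : seq nat := odflt [::] (unpickle k).
have eK s : e (pickle s) = s by rewrite /e pickleK.
pose Q k := [set z | P (e k) z /\ forall j, (j < k)%N ->
  ~ (P (e j) z /\ h (e j) z = h (e k) z)].
have mQ k : measurable (Q k).
  apply: measurable_conj; first exact: mP.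
  apply: measurable_all => j.
  apply: measurable_imp; first exact: measurable_cstP.
  apply: measurable_negP; apply: measurable_conj; first exact: mP.
  by apply: (measurable_coded_eq cJ).
rewrite (_ : (fun _ => _) = (fun z => \sum_(k <oo) (\1_(Q k) z)%:E)).
  apply: ge0_emeasurable_sum => [k z _ _|k _]; first by rewrite lee_fin.
  by apply/measurable_EFinP; exact: measurable_indic.
apply/funext => z.
rewrite (_ : D z = (fun k => h (e k) z) @` [set k | Q k z]).
  rewrite counting_series; first exact: eq_eseriesr.
  move=> j k /set_mem[Pj nj] /set_mem[Pk nk] hjk.
  by case: (ltngtP j k) => // [/nk|/nj]; case.
rewrite DE; apply/seteqP; split=> [y [s Ps hs]|y [k [Pk _] <-]]; last by exists (e k).
have exk : exists k, `[< P (e k) z /\ h (e k) z = y >].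
  by exists (pickle s); apply/asboolP; rewrite eK.
case: (ex_minnP exk) => k /asboolP[Pk hk] kmin; exists k => //; split=> //.
move=> j jk [Pj]; rewrite hk => hj.
by have := kmin j; rewrite leqNgt jk => /(_ (asboolT (conj Pj hj))).
Qed.

(* Counts take countably many values, so preimages are countable unions. *)
Lemma measurable_counting2 (d2 : measure_display) (T : measurableType d2)
    (D D' : Z -> set J) (F : \bar R -> \bar R -> T) :
  enumerated D -> enumerated D' ->
  measurable_fun setT (fun z => F (counting (D z)) (counting (D' z))).
Proof.
move=> eD eD' _ B mB; rewrite setTI.
pose v (o : option nat) : \bar R := if o is Some n then n%:R%:E else +oo.
have cv (A : set J) : exists o, counting A = v o.
  rewrite /counting; case: ifP => _; last by exists None.
  by eexists (Some _).
have mv D0 o : enumerated D0 -> measurable [set z | counting (D0 z) = v o].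
  move=> e0; apply: (@measurable_preim _ _ _ _ _ [set v o]).
    exact: measurable_counting.
  exact: emeasurable_set1.
rewrite (_ : _ @^-1` _ = [set z | exists oo : option nat * option nat,
    (counting (D z) = v oo.1 /\ counting (D' z) = v oo.2) /\ B (F (v oo.1) (v oo.2))]).
  apply: measurable_ex => oo; apply: measurable_conj; last exact: measurable_cstP.
  by apply: measurable_conj; exact: mv.
apply/seteqP; split=> [z /= Bz|z [[n n1] /= [[q1 q2]]]] /=; last by rewrite q1 q2.
have [n e1] := cv (D z); have [n1 e2] := cv (D' z).
by exists (n, n1); rewrite -e1 -e2.
Qed.

Variables (g : nat -> J -> J) (X : Z -> set (J * J)) (b : Z -> J).
Hypothesis mg : forall k, measurable_fun setT (g k).
Hypothesis Xg : forall z x y, X z (x, y) -> exists k, g k x = y.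
Hypothesis mX : forall u v : Z -> J, measurable_fun setT u ->
  measurable_fun setT v -> measurable [set z | X z (u z, v z)].
Hypothesis mb : measurable_fun setT b.

(** The word s stands for the walk from [b z] along the functions [g k] for k in s; [P s] checks
    that all its steps are edges. The edge set may depend on z, as needed for branches. *)
Lemma enumerated_component : enumerated (fun z => component (X z) (b z)).
Proof.
pose fix h s (x : J) {struct s} := if s is k :: s' then h s' (g k x) else x.
pose fix P s z (x : J) {struct s} := if s is k :: s' then
  X z (x, g k x) /\ P s' z (g k x) else True.
exists (fun s => h s \o b), (fun s => [set z | P s z (b z)]); split.
- elim=> [|k s IH] //=.
  have mh : measurable_fun setT (h s).
    elim: s {IH} => [|k' s IHs]; first exact: measurable_id.
    exact: measurableT_comp IHs (mg k').
  by apply: measurableT_comp mb; exact: measurableT_comp mh (mg k).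
- move=> s; elim: s b mb => [|k s IH] u mu /=; first exact: measurable_cstP.
  have mgu : measurable_fun setT (g k \o u) by exact: measurableT_comp.
  by apply: measurable_conj; [exact: mX|exact: IH].
- move=> z; apply/seteqP; split=> y.
    suff H x : joined (X z) x y -> exists2 s, P s z x & h s x = y by exact: H.
    move=> [p []]; elim: p x => [|x' p IH] x /=; first by move=> _ <-; exists [::].
    move=> /andP[/set_mem Xx pp] ly; have [k gk] := Xg Xx.
    have [s Ps hs] := IH _ pp ly.
    by exists (k :: s); rewrite /= ?gk.
  suff H s x : P s z x -> h s x = y -> joined (X z) x y.
    by move=> [s Ps hs]; exact: H Ps hs.
  elim: s x => [|k s IH] x /= => [_ <-|]; first by exists [::].
  move=> [Xx Ps] hs; have [p [pp lp]] := IH _ Ps hs.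
  by exists (g k x :: p); rewrite /= pp mem_set.
Qed.

End enumerated.
(** * Branches of a forest *)

Section joined.
Variable J : choiceType.
Implicit Types X Y : set (J * J).

Lemma joined_refl X x : joined X x x.
Proof. by exists [::]. Qed.

Lemma joined_trans X x y z : joined X x y -> joined X y z -> joined X x z.
Proof.
move=> [p [px py]] [q [qy qz]]; exists (p ++ q).
by rewrite cat_path last_cat px py qy.
Qed.

Lemma joined1 X x y : X (x, y) -> joined X x y.
Proof. by move=> xy; exists [:: y]; rewrite /= mem_set. Qed.

Lemma joined_ind X x (P : J -> Prop) : P x ->
  (forall u v, joined X x u -> P u -> X (u, v) -> P v) ->
  forall v, joined X x v -> P v.
Proof.
move=> Px Pstep v [p [+ <-]]; elim/last_ind: p => //= p u IH.
rewrite rcons_path last_rcons => /andP[px /set_mem Xu].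
by apply: Pstep Xu; [exists p|exact: IH].
Qed.

Lemma joined_sub X Y x y : X `<=` Y -> joined X x y -> joined Y x y.
Proof.
move=> XY; apply: (@joined_ind X x (joined Y x)) => [|u v _ xu uv].
  exact: joined_refl.
by apply: joined_trans xu _; apply: joined1; exact: XY.
Qed.

Lemma joined_sym X x y : symmetric_set X -> joined X x y -> joined X y x.
Proof.
move=> sX; apply: (@joined_ind X x (joined X ^~ x)) => [|u v _ ux uv].
  exact: joined_refl.
by apply: joined_trans ux; apply: joined1; exact: sX.
Qed.

Lemma component_sub X Y x : X `<=` Y -> component X x `<=` component Y x.
Proof. by move=> XY v; exact: joined_sub. Qed.

Lemma component_eq X x y : symmetric_set X -> joined X x y ->
  component X x = component X y.
Proof.
move=> sX xy; apply/seteqP; split=> v; last exact: joined_trans.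
by apply: joined_trans; exact: joined_sym.
Qed.

(** Deleting the edges at x instead of x itself keeps the node set; x becomes isolated. *)
Definition avoid X x := [set p | X p /\ (p.1 <> x /\ p.2 <> x)].

Definition branch X x y := component (avoid X x) y.

Lemma avoid_sub X x : avoid X x `<=` X.
Proof. by move=> p []. Qed.

Lemma avoid_sym X x : symmetric_set X -> symmetric_set (avoid X x).
Proof. by move=> sX u v [/sX ? []]. Qed.

Lemma branch_neq X x y v : y <> x -> branch X x y v -> v <> x.
Proof. by move=> yx; apply: (@joined_ind _ y (fun v => v <> x)) => // u w _ _ [_ []]. Qed.

(** A repetition-free path from x never returns to x after its first edge. *)
Lemma component_branches X x v : component X x v ->
  v = x \/ exists2 y, X (x, y) & branch X x y v.
Proof.
move=> [p [px]]; case/shortenP: px => -[|y q] /= => [_ _ _ <-|]; first by left.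
move=> /andP[/set_mem xy yq] /andP[xyq _] _ qv; right; exists y => //.
exists q; split=> // {qv p xy}; elim: q y yq xyq => //= z q IH y /andP[/set_mem yz zq].
rewrite !inE !negb_or => /and3P[/eqP xy /eqP xz xq].
rewrite mem_set ?IH ?inE ?negb_or ?xq ?andbT//; first exact/eqP.
by split=> //=; split; exact/nesym.
Qed.

End joined.

Definition acyclic (J : choiceType) (X : set (J * J)) : Prop :=
  forall s : seq J, (2 < size s)%N -> ~ ucycle (fun x y => (x, y) \in X) s.

Section forest.
Variables (J : choiceType) (Y : set (J * J)).
Hypotheses (Ysym : symmetric_set Y) (Yirr : forall x, ~ Y (x, x)).
Hypothesis Yacyc : acyclic Y.

(** If two neighbours of x shared a branch, a simple path between them that avoids x would close up
    through x to a cycle. *)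
Lemma branch_inj x y y' v : Y (x, y) -> Y (x, y') ->
  branch Y x y v -> branch Y x y' v -> y = y'.
Proof.
move=> xy xy' yv y'v; apply: contrapT => nyy'.
have yx : y <> x by move=> yx; apply: (@Yirr x); rewrite -{2}yx.
have [p [yp py']] : joined (avoid Y x) y y'.
  by apply: joined_trans yv _; apply: joined_sym y'v; exact: avoid_sym.
move: py'; case/shortenP: yp => {}p yp pU _ py'.
have xp : x \notin p.
  elim: p y {xy yv yx nyy' pU py'} yp => //= z p IH y /andP[/set_mem[_ [_ /= zx]] zp].
  by rewrite inE negb_or (IH _ zp) andbT; apply/eqP/nesym.
have py : p <> [::] by move=> p0; apply: nyy'; rewrite -py' p0.
apply: (Yacyc (s := [:: x, y & p])) => /=.
  by case: (p) py.
move: pU => /= /andP[yNp pU].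
rewrite /ucycle /= rcons_path py' inE negb_or xp yNp pU !mem_set//; last exact: Ysym.
rewrite !andbT /=; apply/andP; split; last exact/eqP/nesym.
by apply: sub_path yp => a b /set_mem[Yab _]; exact: mem_set.
Qed.

(** A point reached from x through a neighbour other than y lies in a branch that misses y, by
    [branch_inj], so it is still reached from x when the edges at y are deleted. *)
Lemma component_edge x y : Y (x, y) ->
  component Y x = branch Y x y `|` branch Y y x.
Proof.
move=> xy; have yx : y <> x by move=> yx; apply: (@Yirr x); rewrite -{2}yx.
apply/seteqP; split=> v.
  move=> /component_branches[->|[y' xy' y'v]].
    by right; exact: joined_refl.
  have [->|nyy'] := pselect (y = y'); first by left.
  right; apply: (@joined_trans _ _ _ y').
    by apply: joined1; split=> //; split; exact/nesym.
  apply: (joined_ind _ _ y'v) => [|u w y'u yu [uw [ux wx]]]; first exact: joined_refl.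
  have nb z : joined (avoid Y x) y' z -> z <> y.
    by move=> + zy; rewrite zy => /branch_inj -/(_ _ xy' xy (joined_refl _ _)) /esym.
  apply: joined_trans yu _; apply: joined1; split=> //; split; first exact: nb.
  by apply: nb; apply: joined_trans y'u _; exact: joined1.
move=> [yv|xv].
  apply: joined_trans (joined1 xy) _; apply: joined_sub yv.
  exact: avoid_sub.
by apply: joined_sub xv; exact: avoid_sub.
Qed.

(** A point on the side of x is either x, which is not in the branch through y, or lies in the
    branch at x through a neighbour other than y. *)
Lemma branch_disjoint x y : Y (x, y) -> branch Y x y `&` branch Y y x = set0.
Proof.
move=> xy; have yx : y <> x by move=> yx; apply: (@Yirr x); rewrite -{2}yx.
rewrite -subset0 => v [yv /component_branches[vx|[y' [xy' [_ y'y]]] y'v]].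
  exact: branch_neq yx yv vx.
apply: y'y; apply/esym; apply: branch_inj xy xy' yv _.
by apply: joined_sub y'v => p [[]].
Qed.

End forest.
(** * Mass transport along edges *)

Lemma ge0_integral_mrestr (R : realType) (d : measure_display)
    (T : measurableType d) (mu : {measure set T -> \bar R}) (D : set T)
    (mD : measurable D) (f : T -> \bar R) :
  measurable_fun setT f -> (forall x, 0 <= f x) ->
  \int[mrestr mu mD]_x f x = \int[mu]_(x in D) f x.
Proof.
move=> mf f0; rewrite -(setUv D) ge0_integral_setU//.
- rewrite (eq_measure_integral mu); last first.
    by move=> A _ AD /=; rewrite /mrestr setIidl.
  rewrite (@eq_measure_integral _ _ _ (~` D) mzero); last first.
    move=> A _ AD /=; rewrite /mrestr (_ : setI _ _ = set0) ?measure0//.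
    by rewrite -subset0 => x [/AD].
  by rewrite integral_measure_zero adde0.
- exact: measurableC.
- exact: measurable_funTS.
- by rewrite disj_set2E setICr.
Qed.

Section edge_measure.
Variables (R : realType) (d : measure_display) (J : measurableType d).
Variables (lambda : probability J R).
Variables (g : nat -> J -> J) (Q : nat -> set J).
Hypothesis mg : forall k, measurable_fun setT (g k).
Hypothesis mQ : forall k, measurable (Q k).
Hypothesis gQ : forall x j k, Q j x -> Q k x -> g j x = g k x -> j = k.

Let mgraph k : measurable_fun setT (fun x => (x, g k x)).
Proof. exact: measurable_fun_pair. Qed.

(* The canonical instance is named because it depends on a measurability
   hypothesis, which unification cannot supply. *)
Definition graph_part (k : nat) : {measure set (J * J) -> \bar R} :=
  measure_function_pushforward__canonical__measure_function_Measure
    (mrestr lambda (mQ k)) (mgraph k).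

(** The integral of the out-degree as a sum of push-forwards of restrictions of [lambda] along the
    graphs of the [g k]: the edge measure before normalisation. *)
Definition outdeg_measure : {measure set (J * J) -> \bar R} :=
  mseries graph_part 0.

Let M := outdeg_measure.

Lemma outdeg_measureE S : M S = \sum_(k <oo) lambda [set x | S (x, g k x) /\ Q k x].
Proof. by []. Qed.

Lemma ge0_integral_outdeg (f : J * J -> \bar R) :
  measurable_fun setT f -> (forall p, 0 <= f p) ->
  \int[M]_p f p = \int[lambda]_x \sum_(k <oo) (\1_(Q k) x)%:E * f (x, g k x).
Proof.
move=> mf f0; have mfg k : measurable_fun setT (fun x => f (x, g k x)).
  exact: measurableT_comp mf (mgraph k).
have mh k : measurable_fun setT (fun x => (\1_(Q k) x)%:E * f (x, g k x)).
  by apply: emeasurable_funM => //; apply/measurable_EFinP; exact: measurable_indic.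
rewrite integral_nneseries//; last by move=> k x _; rewrite mule_ge0// lee_fin.
rewrite ge0_integral_measure_series//; apply: eq_eseriesr => k _.
rewrite ge0_integral_pushforward// preimage_setT.
rewrite (@ge0_integral_mrestr _ _ _ lambda _ _ (fun x => f (x, g k x)))//.
rewrite integral_mkcond; apply: eq_integral => x _.
rewrite patchE indicE; case: ifPn => _; first by rewrite mul1e.
by rewrite mul0e.
Qed.

Lemma counting_xsection (S : set (J * J)) (x : J) :
  (forall y, S (x, y) -> exists2 k, Q k x & g k x = y) ->
  counting (xsection S x) =
    \sum_(k <oo) (\1_[set x | S (x, g k x) /\ Q k x] x)%:E :> \bar R.
Proof.
move=> Sg; rewrite (_ : xsection S x =
    (fun k => g k x) @` [set k | S (x, g k x) /\ Q k x]).
  rewrite counting_series; first exact: eq_eseriesr.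
  by move=> j k /set_mem[_ Qj] /set_mem[_ Qk]; exact: gQ.
rewrite xsectionE; apply/seteqP; split=> [y Sy|_ [k [Sk _] <-]//].
by have [k Qk gk] := Sg _ Sy; exists k => //=; rewrite gk.
Qed.

Lemma measurable_graph_part (S : set (J * J)) k : measurable S ->
  measurable [set x | S (x, g k x) /\ Q k x].
Proof.
move=> mS; apply: measurable_conj; last exact: mQ.
exact: measurable_preim (mgraph k) mS.
Qed.

Lemma integral_deg (S : set (J * J)) (A B : set J) :
  (forall x y, S (x, y) -> exists2 k, Q k x & g k x = y) ->
  measurable S -> measurable A -> measurable B ->
  \int[lambda]_(x in A) deg R S B x = M (S `&` (A `*` B)).
Proof.
move=> Sg mS mA mB; pose S' := S `&` (setT `*` B).
have mS' : measurable S' by apply: measurableI => //; exact: measurableX.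
under eq_integral => x _.
  rewrite /deg (_ : _ `&` _ = xsection S' x); last first.
    by rewrite !xsectionE; apply/seteqP; split=> [y []|y [? []]].
  rewrite counting_xsection; last by move=> y [/Sg].
  over.
rewrite integral_nneseries//; last first.
- by move=> k; apply: measurable_funTS; apply/measurable_EFinP;
    apply: measurable_indic; exact: measurable_graph_part.
rewrite outdeg_measureE; apply: eq_eseriesr => k _.
rewrite integral_indic//; last exact: measurable_graph_part.
congr (lambda _); apply/seteqP; split=> [x [[[? []] ?] ?]|x [[? []] ?]]; by [].
Qed.

Lemma measure_prod_unique (m1 m2 : {measure set (J * J) -> \bar R}) :
  m1 setT < +oo ->
  (forall A B, measurable A -> measurable B -> m1 (A `*` B) = m2 (A `*` B)) ->
  forall S, measurable S -> m1 S = m2 S.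
Proof.
move=> m1oo m12; apply: (@measure_unique _ _ _
  [set A `*` B | A in measurable & B in measurable] (fun=> setT)) => //.
- by rewrite measurable_prod_measurableType.
- move=> _ _ [A mA [B mB <-]] [A' mA' [B' mB' <-]]; rewrite -setXI.
  by exists (A `&` A'); [exact: measurableI|exists (B `&` B') => //; exact: measurableI].
- by move=> _; exists setT => //; exists setT; rewrite ?setXTT.
- by rewrite bigcup_const.
- by move=> _ [A mA [B mB <-]]; exact: m12.
Qed.

(** Both sides are finite measures that agree on rectangles by [integral_deg]. *)
Lemma edge_measure_outdeg (E : set (J * J)) (eta : probability (J * J)%type R) :
  (forall x y, E (x, y) -> exists2 k, Q k x & g k x = y) ->
  measurable E -> edge_measure lambda E eta -> forall S, measurable S ->
  eta S = ((avg_degree lambda E)^-1)%:E * M (S `&` E).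
Proof.
move=> Eg mE eE.
have a0 : (0 <= (avg_degree lambda E)^-1)%R.
  rewrite invr_ge0 /avg_degree fine_ge0//; apply: integral_ge0 => x _.
  exact: counting_ge0.
apply: (@measure_prod_unique eta (mscale (NngNum a0) (mrestr M mE))).
  exact: (le_lt_trans (probability_le1 eta measurableT) (ltry _)).
move=> A B mA mB; apply: eq_trans (eE A B mA mB) _.
rewrite (integral_deg Eg)//.
by rewrite /= /mscale /= /mrestr setIC.
Qed.

(** On rectangles this is the defining identity of a graphing. The degree bound makes [M] finite, so
    the identity extends to all Borel sets. *)
Lemma outdeg_measure_sym (E : set (J * J)) :
  (forall x y, E (x, y) <-> exists2 k, Q k x & g k x = y) ->
  graphing lambda E -> forall S, measurable S -> M (@unstable.swap J J @^-1` S) = M S.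
Proof.
move=> Eg [_ [mE Esym _] [D degD] degAB].
have MI S : M (E `&` S) = M S.
  rewrite !outdeg_measureE; apply: eq_eseriesr => k _; congr (lambda _).
  apply/seteqP; split=> x [Sx Qx]; split=> //; first by case: Sx.
  by split=> //; apply/Eg; exists k.
have MT : M setT < +oo.
  rewrite -(@setXTT J J) -MI -integral_deg//; last by move=> x y /Eg.
  have mdeg : measurable_fun setT (deg R E setT).
    rewrite (_ : deg R E setT =
        (fun x => \sum_(k <oo) (\1_[set x | E (x, g k x) /\ Q k x] x)%:E)).
      apply: ge0_emeasurable_sum => [k x _ _|k _]; first by rewrite lee_fin.
      apply/measurable_EFinP; apply: measurable_indic.
      exact: measurable_graph_part.
    apply/funext => x; rewrite /deg setIT counting_xsection// => y.
    by move/Eg.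
  apply: (@le_lt_trans _ _ (\int[lambda]_x (cst D%:R%:E) x)).
    by apply: ge0_le_integral => // x _; exact: degD.
  rewrite integral_cst// [X in _ * X](_ : _ = 1) ?mule1 ?ltry//.
  exact: probability_setT.
pose P : {measure set (J * J) -> \bar R} :=
  measure_function_pushforward__canonical__measure_function_Measure M
    (@measurable_swap _ _ J J).
have MP A B : measurable A -> measurable B -> M (A `*` B) = P (A `*` B).
  move=> mA mB.
  rewrite -MI -integral_deg//; last by move=> x y /Eg.
  rewrite degAB// integral_deg//; last by move=> x y /Eg.
  rewrite MI /= /pushforward; congr (M _).
  by apply/seteqP; split=> [[x y] []|[x y] []].
by move=> S mS; exact/esym/(measure_prod_unique MT MP).
Qed.

End edge_measure.

(** * The flow on a forest with finite components *)

Section transport.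
Variables (R : realType) (d : measure_display) (J : measurableType d).
Variables (c : J -> nat -> nat) (lambda : probability J R).
Variables (g : nat -> J -> J) (Q : nat -> set J) (E : set (J * J)).
Hypothesis cJ : coded c.
Hypothesis mg : forall k, measurable_fun setT (g k).
Hypothesis mQ : forall k, measurable (Q k).
Hypothesis gQ : forall x j k, Q j x -> Q k x -> g j x = g k x -> j = k.
Hypothesis Eg : forall x y, E (x, y) <-> exists2 k, Q k x & g k x = y.

Let M := outdeg_measure lambda mg mQ.

Variable Y : set (J * J).
Hypotheses (mY : measurable Y) (YE : Y `<=` E).

Let Yg x y : Y (x, y) -> exists k, g k x = y.
Proof. by move=> /YE/Eg[k _ <-]; exists k. Qed.

Lemma enumerated_component_at (d' : measure_display) (Z : measurableType d')
    (b : Z -> J) :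
  measurable_fun setT b -> enumerated (fun z => component Y (b z)).
Proof.
move=> mb; apply: (@enumerated_component _ _ _ _ g (fun=> Y)) => // u v mu mv.
exact: measurable_preim (measurable_fun_pair mu mv) mY.
Qed.

Lemma enumerated_component_id : enumerated (component Y).
Proof. exact: (@enumerated_component_at _ J id (@measurable_id _ _ _)). Qed.

Lemma enumerated_branch :
  enumerated (fun p : J * J => branch Y p.1 p.2).
Proof.
apply: (@enumerated_component _ _ _ _ g (fun p => avoid Y p.1)) => //.
- by move=> p x y [/Yg].
- move=> u v mu mv; apply: measurable_conj.
    exact: measurable_preim (measurable_fun_pair mu mv) mY.
  apply: measurable_conj; apply: measurable_negP.
    exact: measurable_coded_eq cJ mu measurable_fst.
  exact: measurable_coded_eq cJ mv measurable_fst.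
Qed.

Lemma measurable_branch x y : measurable (branch Y x y).
Proof. exact: (enumerated_measurable cJ (x, y) enumerated_branch). Qed.

Lemma measurable_point (x : J) : measurable [set x].
Proof.
rewrite (_ : [set x] = [set y | y = x])//.
by apply: (measurable_coded_eq cJ); [exact: measurable_id|exact: measurable_cst].
Qed.

Hypothesis Msym : forall S, measurable S -> M (@unstable.swap J J @^-1` S) = M S.
Hypotheses (Ysym : symmetric_set Y) (Yirr : forall x, ~ Y (x, x)).
Hypotheses (Yacyc : acyclic Y) (Yfin : forall x, finite_set (component Y x)).

Variable A : set J.
Hypotheses (mA : measurable A) (AY : forall x, exists2 y, component Y x y & A y).

Definition component_count x : R := fine (counting (A `&` component Y x)).
Let n := component_count.

Let NE x : counting (A `&` component Y x) = (n x)%:E :> \bar R.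
Proof.
rewrite /n fineK//; apply/counting_fin_num.
by apply: sub_finite_set (Yfin x) => y [].
Qed.

Lemma component_count_ge1 x : (1 <= n x)%R.
Proof.
have [y Cy Ay] := AY x.
by rewrite -lee_fin -NE; apply: (counting_ge1 R (x := y)).
Qed.

Let n_gt0 x : (0 < n x)%R.
Proof. exact: lt_le_trans ltr01 (component_count_ge1 x). Qed.

(** Only the values on edges of [Y] enter; there the branch is finite and [fine] loses nothing. *)
Definition flow (p : J * J) : R :=
  (fine (counting (A `&` branch Y p.1 p.2)) / n p.1)%R.

Let flow_ge0 p : (0 <= flow p)%R.
Proof. by rewrite divr_ge0 ?fine_ge0 ?counting_ge0//; exact/ltW/n_gt0. Qed.

Lemma measurable_flow : measurable_fun setT flow.
Proof.
have eC := enumerated_setI mA (enumerated_component_at (@measurable_fst _ _ J J)).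
have eB := enumerated_setI mA enumerated_branch.
exact: (measurable_counting2 (T := R) cJ (fun r s => fine r / fine s)%R eB eC).
Qed.

Let countingU (B C : set J) : measurable B -> measurable C -> B `&` C = set0 ->
  counting (B `|` C) = counting B + counting C :> \bar R.
Proof. exact: (@measureU _ R J (@counting J R)). Qed.

Let branch_fin x y : Y (x, y) ->
  counting (A `&` branch Y x y) = (flow (x, y) * n x)%:E :> \bar R.
Proof.
move=> xy; rewrite /flow /= divfK ?gt_eqF// fineK//; apply/counting_fin_num.
apply: sub_finite_set (Yfin x) => v [_].
by rewrite (component_edge Ysym Yirr Yacyc xy); left.
Qed.

(** The edge splits the component into two disjoint branches, and both endpoints have the same
    denominator. *)
Lemma flow_edge x y : Y (x, y) -> (flow (x, y) + flow (y, x) = 1)%R.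
Proof.
move=> xy; have nn : n y = n x.
  by rewrite /n /component_count (component_eq Ysym (joined1 xy)).
have := NE x; rewrite (component_edge Ysym Yirr Yacyc xy) setIUr countingU.
- rewrite !branch_fin//; last exact: Ysym.
  rewrite nn -EFinD => -[]; rewrite -mulrDl => /(congr1 (fun r => r / n x)%R).
  by rewrite mulfK ?divff// gt_eqF.
- by apply: measurableI => //; exact: measurable_branch.
- by apply: measurableI => //; exact: measurable_branch.
- by rewrite setIACA setIid (branch_disjoint Ysym Yirr Yacyc xy) setI0.
Qed.

(** The branches at x are disjoint and, together with x, make up its component. Counting the points
    of [A] in them and dividing by [n x] gives the formula. *)
Lemma flow_out x :
  \sum_(k <oo) (\1_(Q k) x)%:E * ((EFin \o flow) \_ Y) (x, g k x) =
    (1 - \1_A x / n x)%:E.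
Proof.
pose F k := if `[< Y (x, g k x) /\ Q k x >] then A `&` branch Y x (g k x) else set0.
have mF k : measurable (F k).
  rewrite /F; case: ifP => // _; apply: measurableI => //.
  exact: measurable_branch.
have tF : trivIset setT F.
  move=> j k _ _; rewrite /F; case: asboolP => [[Yj Qj]|_]; last by rewrite set0I => -[].
  case: asboolP => [[Yk Qk]|_]; last by rewrite setI0 => -[].
  move=> [v [[_ vj] [_ vk]]]; apply: gQ Qj Qk _.
  exact: (branch_inj Ysym Yirr Yacyc Yj Yk vj vk).
have UF : A `&` component Y x = (\bigcup_k F k) `|` (A `&` [set x]).
  apply/seteqP; split=> [v [Av /component_branches[vx|[y Yy vy]]]|v [[k _]|[Av vx]]].
  - by right; split.
  - left; have [k Qk gk] := (Eg _ _).1 (YE Yy); exists k => //.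
    by rewrite /F asboolT gk.
  - rewrite /F; case: asboolP => // -[Yk _] [Av vk]; split=> //.
    by rewrite (component_edge Ysym Yirr Yacyc Yk); left.
  - by split=> //; rewrite vx; exact: joined_refl.
have xF : (\bigcup_k F k) `&` (A `&` [set x]) = set0.
  rewrite -subset0 => v [[k _]]; rewrite /F; case: asboolP => // -[Yk _] [_ vk] [_ vx].
  apply: (branch_neq _ vk vx) => gx; apply: (Yirr (x := x)).
  by rewrite -{2}gx.
have cx : counting (A `&` [set x]) = (\1_A x)%:E :> \bar R.
  rewrite indicE; have [xA|xA] := boolP (x \in A).
    rewrite setIidr; last by move=> _ ->; exact: set_mem.
    by rewrite /counting asboolT ?fset_set1 ?finmap.cardfs1.
  rewrite (_ : _ `&` _ = set0); first by rewrite /counting asboolT// fset_set0.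
  by rewrite -subset0 => v [Av vx]; move/negP: xA; apply; rewrite inE -vx.
have S1 : \sum_(k <oo) counting (F k) = (n x - \1_A x)%:E :> \bar R.
  have mUF : measurable (\bigcup_k F k) by exact: bigcup_measurable.
  have : counting (\bigcup_k F k) = \sum_(k <oo) counting (F k) :> \bar R.
    exact: (@measure_semi_bigcup _ _ _ (@counting J R)).
  move=> <-; have := NE x; rewrite UF countingU//; last first.
    by apply: measurableI => //; exact: measurable_point.
  rewrite cx EFinB => <-; rewrite addeK//.
transitivity (\sum_(k <oo) ((n x)^-1)%:E * counting (F k)).
  apply: eq_eseriesr => k _; rewrite patchE indicE /F.
  case: asboolP => [[Yk Qk]|nYQ].
    rewrite !mem_set// mul1e branch_fin// -EFinM mulrCA mulVf ?mulr1// gt_eqF//.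
  rewrite [X in _ = _ * X](_ : _ = 0); last by rewrite /counting asboolT// fset_set0.
  rewrite mule0; case: ifPn => [/set_mem Yk|_]; last by rewrite mule0.
  rewrite memNset ?mul0e// => Qk; exact: nYQ.
rewrite nneseriesZl; last by move=> k _; exact: counting_ge0.
by rewrite S1 -EFinM mulrBr mulVf ?gt_eqF// mulrC.
Qed.

(** By [flow_edge] the flow and its reversal add up to the indicator of [Y]. By symmetry of [M] they
    have the same integral, which is the integral of the outflow. *)
Lemma outdeg_forest :
  (2^-1)%:E * M Y = \int[lambda]_x (1 - \1_A x / n x)%:E.
Proof.
pose f : J * J -> \bar R := (EFin \o flow) \_ Y.
have mf : measurable_fun setT f.
  apply/(measurable_restrictT _ mY); apply: measurable_funTS.
  by apply/measurable_EFinP; exact: measurable_flow.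
have f0 p : 0 <= f p by rewrite /f patchE; case: ifP => // _; rewrite lee_fin flow_ge0.
have mfs : measurable_fun setT (f \o @unstable.swap J J).
  by apply: measurableT_comp mf _; exact: measurable_swap.
have <- : \int[M]_p f p = \int[lambda]_x (1 - \1_A x / n x)%:E.
  rewrite (ge0_integral_outdeg lambda mg mQ mf f0).
  by apply: eq_integral => x _; exact: flow_out.
have fs : \int[M]_p f p = \int[M]_p f (unstable.swap p).
  transitivity (\int[pushforward M (@unstable.swap J J)]_p f p).
    pose P : {measure set (J * J) -> \bar R} :=
      measure_function_pushforward__canonical__measure_function_Measure M
      (@measurable_swap _ _ J J).
    by apply: (eq_measure_integral P) => S mS _ /=; rewrite /pushforward Msym.
  rewrite ge0_integral_pushforward//; exact: measurable_swap.
have -> : M Y = \int[M]_p f p + \int[M]_p f p.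
  rewrite {2}fs -ge0_integralD//.
  rewrite -[in LHS](setIT Y) -integral_indic//.
  apply: eq_integral => -[x y] _.
  rewrite /f !patchE indicE /=; case: ifPn => [/set_mem Yxy|Yxy].
    by rewrite mem_set; [rewrite -EFinD flow_edge|exact: Ysym].
  rewrite memNset ?adde0// => /Ysym xy.
  by move: Yxy; rewrite mem_set.
rewrite -mule2n -(mule_natl _ 2) muleA -EFinM mulVf// mul1e//.
Qed.

End transport.

(** * The rank function as an integral *)

Section rho.
Variable R : realType.

Lemma fine_inv_ge1 (a : \bar R) : 1 <= a -> (0 <= fine a^-1 <= 1)%R.
Proof.
case: a => [r| |] //=; last by rewrite lexx ler01.
rewrite lee_fin => r1; have r0 := lt_le_trans ltr01 r1.
by rewrite fine_invr invr_ge0 ltW//= invf_le1.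
Qed.

Lemma le_fine_inv (a b : \bar R) : 1 <= a -> a <= b ->
  (fine b^-1 <= fine a^-1)%R.
Proof.
case: a => [r| |] //; last by move=> _; rewrite leye_eq => /eqP ->.
rewrite lee_fin => r1; have r0 := lt_le_trans ltr01 r1.
case: b => [s| |] //; last by rewrite fine_invr /= invr_ge0 => _; exact: ltW.
rewrite lee_fin => rs; rewrite !fine_invr lef_pV2// posrE.
exact: lt_le_trans rs.
Qed.

Variables (d : measure_display) (J : measurableType d).
Variables (lambda : probability J R).

Definition inv_component (X : set (J * J)) (u : J) : R :=
  fine (@counting J R (component X u))^-1.

Lemma inv_component_itv (X : set (J * J)) u :
  (0 <= inv_component X u <= 1)%R.
Proof.
apply: fine_inv_ge1; apply: (counting_ge1 R (x := u)); exact: joined_refl.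
Qed.

Lemma inv_component_sub (X Y : set (J * J)) u : X `<=` Y ->
  (inv_component Y u <= inv_component X u)%R.
Proof.
move=> XY; apply: le_fine_inv; last exact/le_counting/component_sub.
apply: (counting_ge1 R (x := u)); exact: joined_refl.
Qed.

(** The two integrands add up to 1, and the expectation is finite, so it may be subtracted in the
    extended reals. *)
Lemma rhoE (X : set (J * J)) : measurable_fun setT (inv_component X) ->
  rho lambda X = \int[lambda]_x (1 - inv_component X x)%:E.
Proof.
move=> mX; rewrite /rho expectation.unlock.
have q01 := inv_component_itv X.
have mX1 : measurable_fun setT (fun x => (1 - inv_component X x)%R).
  exact: measurable_funB.
have I1 : \int[lambda]_x (inv_component X x)%:E +
    \int[lambda]_x (1 - inv_component X x)%:E = 1.
  rewrite -ge0_integralD//.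
  - under eq_integral do rewrite -EFinD addrC subrK.
    rewrite (@integral_cst _ _ _ lambda setT measurableT 1) mul1e.
    exact: probability_setT.
  - by move=> x _; rewrite lee_fin; case/andP: (q01 x).
  - exact/measurable_EFinP.
  - by move=> x _; rewrite lee_fin subr_ge0; case/andP: (q01 x).
  - exact/measurable_EFinP.
rewrite -[in LHS]I1 addeC addeK// ge0_fin_numE.
  rewrite (@le_lt_trans _ _ 1) ?ltry// -I1 leeDl//; apply: integral_ge0 => x _.
  by rewrite lee_fin subr_ge0; case/andP: (q01 x).
by apply: integral_ge0 => x _; rewrite lee_fin; case/andP: (q01 x).
Qed.

End rho.

(** * Spanning forests and the comparison of alpha with rho *)

Lemma forest_acyclic (J : choiceType) (E F : set (J * J)) : F `<=` E ->
  (forall u, tree_on (component E u) (F `&` (component E u `*` component E u))) ->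
  acyclic F.
Proof.
move=> FE tF [//|u s] s2 /andP[cs us].
have [_ _ nT] := tF u; apply: (nT (u :: s) s2).
rewrite /ucycle us andbT.
suff H x p : component E u x -> path (fun x y => (x, y) \in F) x p ->
    path (fun x y => (x, y) \in F `&` (component E u `*` component E u)) x p.
  by apply: H => //; exact: joined_refl.
elim: p x => //= y p IH x ux /andP[/set_mem xy yp].
have uy : component E u y by apply: joined_trans ux _; exact/joined1/FE.
by rewrite IH// andbT mem_set.
Qed.

Lemma tree_component (J : choiceType) (E F : set (J * J)) u : F `<=` E ->
  tree_on (component E u) (F `&` (component E u `*` component E u)) ->
  component E u = component F u.
Proof.
move=> FE [_ tF _]; apply/seteqP; split=> v; last exact: component_sub.
move=> uv; apply: joined_sub (tF u v (joined_refl _ _) uv).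
by move=> p [].
Qed.

Theorem corollary4p5 (R : realType) (d : measure_display)
    (J : measurableType d) (lambda : probability J R)
    (E F : set (J * J)) (eta : probability (J * J)%type R)
    (hG : graphing lambda E) (hd : (0 < avg_degree lambda E)%R)
    (heta : edge_measure lambda E eta)
    (hF : hyperfinite_spanning_subforest lambda E F) :
  let alpha := fun X : set (J * J) =>
    (avg_degree lambda E / 2)%:E * eta (X `&` F) in
  [/\ is_measure_on (borel_edges E) alpha,
      forall X, borel_edges E X -> alpha X <= rho lambda X &
      alpha E = rho lambda E].
Proof.
move=> alpha; have [/standard_borel_coded[c cJ] [mE Esym Eirr] [D degD] _] := hG.
have [[mF Fsym FE] [eta' heta' hypF] treeF] := hF.
have fE x : finite_set (xsection E x).
  apply/(counting_fin_num R); rewrite ge0_fin_numE ?counting_ge0//.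
  apply: (@le_lt_trans _ _ (D%:R%:E)); last exact: ltry.
  by have := degD x; rewrite /deg setIT.
have [g [Q [mg mQ Eg gQ]]] := Lusin_Novikov cJ mE fE.
pose M := outdeg_measure lambda mg mQ.
have Msym := outdeg_measure_sym mg mQ gQ Eg hG.
have Eg' S : S `<=` E -> forall x y, S (x, y) -> exists2 k, Q k x & g k x = y.
  by move=> SE x y /SE/Eg.
(* The factor in alpha cancels the normalisation of the edge measure, leaving half of [M]. *)
have ME S : measurable S -> S `<=` E ->
    (avg_degree lambda E / 2)%:E * eta S = (2^-1)%:E * M S.
  move=> mS SE.
  rewrite (edge_measure_outdeg mg mQ gQ (Eg' _ (@subset_refl _ E)) mE heta)//.
  by rewrite setIidl// muleA -EFinM mulrAC divff ?gt_eqF// mul1r.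
have alphaE X : measurable X -> alpha X = (2^-1)%:E * M (X `&` F).
  move=> mX; rewrite /alpha ME//; first exact: measurableI.
  by move=> p [_ /FE].
have small e : (0 < e)%R -> exists N, [/\ borel_edges F N, M N < e%:E &
    forall u, finite_set (component (F `\` N) u)].
  move=> e0; have F'E := edge_measure_outdeg mg mQ gQ (Eg' _ FE) mF heta'.
  (* Otherwise the probability measure [eta'] would vanish. Positivity allows passing from [eta'] to
     [M] by rescaling the bound. *)
  have a0 : (0 < (avg_degree lambda F)^-1)%R.
    rewrite lt_neqAle eq_sym invr_ge0 /avg_degree fine_ge0 ?andbT; last first.
      by apply: integral_ge0 => x _; exact: counting_ge0.
    apply/eqP => a0; have := F'E _ measurableT.
    rewrite /avg_degree a0 mul0e => /eqP; rewrite [X in X == _](_ : _ = 1).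
      by rewrite onee_eq0.
    exact: probability_setT.
  have [|N [[mN Nsym NF] Ne Nfin]] := hypF (e * (avg_degree lambda F)^-1)%R.
    by rewrite mulr_gt0.
  exists N; split=> //; move: Ne; rewrite F'E// setIidl// muleC.
  by rewrite EFinM lte_pmul2r// lte_fin.
have Fac := forest_acyclic FE treeF.
have Yac Y : Y `<=` F -> acyclic Y.
  move=> YF s s2 /andP[cs us]; apply: (Fac s s2); rewrite /ucycle us andbT.
  by apply: sub_cycle cs => x y /set_mem/YF/mem_set.
have mcomp X : measurable X -> X `<=` E -> measurable_fun setT (@inv_component R _ J X).
  move=> mX XE; have eC := enumerated_component_id mg Eg mX XE.
  exact: (measurable_counting2 (T := R) cJ (fun r _ => fine r^-1) eC eC).
have rhoX X : measurable X -> X `<=` E ->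
    rho lambda X = \int[lambda]_x (1 - inv_component R X x)%:E.
  by move=> mX XE; apply: rhoE; exact: mcomp.
have le_rho X : borel_edges E X -> alpha X <= rho lambda X.
  move=> [mX Xsym XE]; apply/lee_addgt0Pr => e e0.
  have [N [[mN Nsym NF] Ne Nfin]] := small e e0.
  pose Y := (X `&` F) `\` N.
  have mY : measurable Y by apply: measurableD => //; exact: measurableI.
  have YF : Y `<=` F by move=> p [[]].
  have YE := subset_trans YF FE.
  have Ysym : symmetric_set Y.
    move=> x y [[/Xsym ? /Fsym ?] Nxy]; split=> // /Nsym; exact: Nxy.
  have Yfin x : finite_set (component Y x).
    by apply: sub_finite_set (Nfin x); apply: component_sub => p [[_ Fp] Np].
  have AY x : exists2 y, component Y x y & [set: J] y.
    by exists x => //; exact: joined_refl.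
  have Yirr x : ~ Y (x, x) by move=> /YE; exact: Eirr.
  have := outdeg_forest cJ gQ Eg mY YE Msym Ysym Yirr (Yac _ YF) Yfin
    measurableT AY.
  rewrite -/M => MY.
  (* Restoring the removed edges costs at most the mass of [N], which is below [e]. *)
  have MXF : M (X `&` F) <= M Y + M N.
    rewrite -measureU//; last first.
      by rewrite -subset0 => p [[]].
    apply: le_measure; rewrite ?inE//.
    - exact: measurableI.
    - exact: measurableU.
    - by move=> p XFp; have [?|?] := pselect (N p); [right|left].
  rewrite alphaE//; apply: (@le_trans _ _ ((2^-1)%:E * (M Y + M N))).
    by rewrite lee_pmul2l// lte_fin invr_gt0.
  rewrite ge0_muleDr//; apply: leeD; last first.
    by apply: le_trans (ltW Ne); rewrite gee_pMl// lee_fin invf_le1// ler1n.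
  have -> : (2^-1)%:E * M Y = \int[lambda]_x (1 - inv_component R Y x)%:E.
    rewrite MY; apply: eq_integral => x _; congr (1 - _)%:E.
    rewrite indicT div1r /component_count setTI -fine_invr fineK//.
    exact/counting_fin_num.
  (* [Y] lies in [X], so its components are no larger and their inverse sizes no smaller. *)
  rewrite rhoX//; apply: ge0_le_integral => //.
  - by move=> x _; rewrite lee_fin subr_ge0; case/andP: (inv_component_itv R Y x).
  - by apply/measurable_EFinP; apply: measurable_funB => //; exact: mcomp.
  - by apply/measurable_EFinP; apply: measurable_funB => //; exact: mcomp.
  - move=> x _; rewrite lee_fin lerD2l lerN2; apply: inv_component_sub.
    by move=> p [[]].
split=> //.
- split.
  + by rewrite /alpha set0I measure0 mule0.
  + by move=> X _; rewrite mule_ge0// lee_fin divr_ge0// ltW.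
  + move=> X bX tX; have mXF n : measurable (X n `&` F).
      by have [mX _ _] := bX n; exact: measurableI.
    rewrite /alpha setI_bigcupl measure_semi_bigcup//.
    * by rewrite -nneseriesZl// => n _; exact: measure_ge0.
    * move=> i j _ _ [p [[Xi _] [Xj _]]]; apply: tX => //.
      by exists p.
    * exact: bigcup_measurable.
have bE : borel_edges E E by split.
apply/eqP; rewrite eq_le (le_rho _ bE) /=; apply/lee_addgt0Pr => e e0.
have [N [[mN Nsym NF] Ne Nfin]] := small e e0.
pose Y := F `\` N.
have mY : measurable Y by exact: measurableD.
have YF : Y `<=` F by move=> p [].
have YE := subset_trans YF FE.
have Ysym : symmetric_set Y.
  by move=> x y [/Fsym ? Nxy]; split=> // /Nsym; exact: Nxy.
have Yirr x : ~ Y (x, x) by move=> /YE; exact: Eirr.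
(* The endpoints of [N]. As a union over k this set is measurable, and subadditivity bounds its
   measure by [M N]. *)
pose touch := \bigcup_k [set x | N (x, g k x) /\ Q k x].
have mtouch : measurable touch.
  by apply: bigcup_measurable => k _; exact: (measurable_graph_part mg mQ k mN).
have touchP x y : N (x, y) -> touch x.
  move=> Nxy; have [k Qk gk] := (Eg _ _).1 (FE _ (NF _ Nxy)).
  by exists k => //; split=> //; rewrite gk.
have touchM : lambda touch <= M N.
  by apply: measure_sigma_subadditive => // k; exact: (measurable_graph_part mg mQ k mN).
pose B := [set x | exists2 y, component Y x y & touch y].
have mB : measurable B.
  exact: (enumerated_meets mtouch (enumerated_component_id mg Eg mY YE)).
(* [A] meets a component of [Y] in its touched points if there are any, and contains it entirely
   otherwise. *)
pose A := touch `|` ~` B.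
have mA : measurable A by apply: measurableU => //; exact: measurableC.
have AY x : exists2 y, component Y x y & A y.
  have [[y xy ty]|nB] := pselect (B x); first by exists y => //; left.
  by exists x; [exact: joined_refl|right].
have := outdeg_forest cJ gQ Eg mY YE Msym Ysym Yirr (Yac _ YF) Nfin mA AY.
rewrite -/M; set n := component_count R Y A => MY.
have n_ge1 x : (1 <= n x)%R by exact: component_count_ge1.
have An01 x : (0 <= \1_A x / n x <= 1)%R.
  have n0 := lt_le_trans ltr01 (n_ge1 x).
  by rewrite divr_ge0 ?(ltW n0)//= ler_pdivrMr// mul1r (le_trans _ (n_ge1 x)).
have mh : measurable_fun setT (fun x => (1 - \1_A x / n x)%:E).
  apply/measurable_EFinP; apply: measurable_funB => //.
  apply: measurable_funM; first exact: measurable_indic.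
  have eC := enumerated_setI mA (enumerated_component_id mg Eg mY YE).
  exact: (measurable_counting2 (T := R) cJ (fun r _ => (fine r)^-1)%R eC eC).
have mt : measurable_fun setT (fun x => (\1_touch x)%:E : \bar R).
  by apply/measurable_EFinP; exact: measurable_indic.
have h0 x : 0 <= (1 - \1_A x / n x)%:E :> \bar R.
  by rewrite lee_fin subr_ge0; case/andP: (An01 x).
have t0 x : 0 <= (\1_touch x)%:E :> \bar R by rewrite lee_fin.
have : rho lambda E <= (2^-1)%:E * M Y + lambda touch.
  rewrite MY rhoX// -[touch]setIT -(integral_indic lambda measurableT mtouch).
  rewrite -ge0_integralD//; apply: ge0_le_integral => //.
  - by move=> x _; rewrite lee_fin subr_ge0; case/andP: (inv_component_itv R E x).
  - by apply/measurable_EFinP; apply: measurable_funB => //; exact: mcomp.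
  - exact: emeasurable_funD.
  - move=> x _; rewrite -EFinD lee_fin.
    have /andP[q0 q1] := inv_component_itv R E x; have /andP[_ An1] := An01 x.
    (* Three cases: at a touched point the added indicator suffices; at an untouched point of [B]
       the indicator of [A] is 0; outside [B] the component of x in [Y] is its component in [E], and
       the inverse sizes agree. *)
    have [tx|ntx] := pselect (touch x).
      rewrite [\1_touch x]indicE mem_set//; apply: (@le_trans _ _ 1%R).
        by rewrite lerBlDr lerDl.
      by rewrite lerDr subr_ge0.
    rewrite [\1_touch x]indicE memNset// addr0 lerD2l lerN2 indicE.
    have [nBx|Bx] := pselect (~ B x); last first.
      by rewrite memNset ?mul0r// => -[].
    rewrite mem_set; last by right.
    have Cxy y : component Y x y -> ~ B y.
      by move=> xy [z yz tz]; apply: nBx; exists z => //; exact: joined_trans xy yz.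
    have CYE : component Y x = component E x.
      rewrite (tree_component FE (treeF x)); apply/seteqP; split.
        exact: component_sub.
      (* A walk in [F] from x uses no edge of [N]: the first such edge would start at a touched
         point of the component of x in [Y]. *)
      apply: (@joined_ind _ F x (component Y x)) => [|u v _ xu uv].
        exact: joined_refl.
      apply: joined_trans (xu) _; apply: joined1; split=> // Nuv.
      by apply: nBx; exists u; [exact: xu|exact: touchP Nuv].
    have AC : A `&` component Y x = component Y x.
      by rewrite setIidr// => y /Cxy; right.
    rewrite div1r /n /component_count AC -fine_invr fineK ?CYE//.
    by rewrite -CYE; exact/counting_fin_num.
move=> /le_trans; apply; rewrite alphaE// setIidr//.
apply: leeD; last exact: le_trans touchM (ltW Ne).
by rewrite lee_pmul2l ?lte_fin ?invr_gt0//; apply: le_measure; rewrite ?inE.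
Qed.
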